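(* Let $K$ be a triangulation of a closed orientable PL 3-manifold, let $\mathcal C$ be an admissible subset of its edges, $\overline{\mathcal C}$ its complement in the set of all edges, and $f=\det(A|_{\mathcal C})$. Then the following differential form (taken in absolute value) on the variety of permitted length configurations on the edges of the complex (the degree of the form coincides with the dimension of the variety): $$\left|\frac{\prod_{\text{over all edges}}l\;\bigwedge_{i\in\overline{\mathcal C}}dl_i}{\sqrt{|f|\prod_{\text{over all tetrahedra}}6V}}\right| ,$$ where $l$ are edge lengths and $V$ volumes of tetrahedra, remains unchanged under $2\leftrightarrow3$ Pachner moves and under a different choice of the admissible subset $\mathcal C$ in the set of edges.
   Context: Setting. $K$ is a finite simplicial complex triangulating the closed oriented manifold, with a consistent orientation of all its tetrahedra. All vertices of $K$ are mapped to points of Euclidean space $\mathbb R^3$ (with its own fixed orientation); every edge acquires a Euclidean length and every tetrahedron is mapped affinely to a Euclidean tetrahedron of volume $V>0$; self-intersections between the images of tetrahedra are allowed. The resulting collection of lengths is called a permitted length configuration. ''Generic'' means: for vertex placements in the complement of a proper algebraic subset; all forms are considered at generic points. Defect angles. For edge lengths near a permitted length configuration (not necessarily permitted), the defect angle $\omega_j$ around edge $j$ is, modulo $2\pi$, the algebraic sum of the interior dihedral angles at $j$ in the tetrahedra containing $j$, taken with sign $-$ for the tetrahedra that do not change their orientation under the map into $\mathbb R^3$, and with sign $+$ for the others. Matrix. $A=(\partial\omega_j/\partial l_k)$, with $j,k$ running over all edges, evaluated at the permitted configuration. It is symmetric. $A|_{\mathcal C}$ is the submatrix with rows and columns in $\mathcal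 C$. A subset $\mathcal C$ of edges is admissible if, at generic permitted configurations, $A|_{\mathcal C}$ is nondegenerate and $|\mathcal C|=\operatorname{rank}A$. Forms on the variety of permitted configurations. The differentials $dl_i$ are taken for zero curvatures: at a generic permitted configuration they are restricted to the linear space $\ker A$ of infinitesimal length deformations $(dl_k)$ for which all $d\omega_j=0$; this space plays the role of the tangent space, and its dimension is $|\overline{\mathcal C}|$. Move. A $2\to3$ Pachner move replaces two tetrahedra $ABCD$ and $ABCE$ with common 2-face $ABC$ by three tetrahedra $ABDE$, $BCDE$, $CADE$ with the new common edge $DE$, keeping the rest of the complex and the positions of the vertices in $\mathbb R^3$; the length of $DE$ is the Euclidean distance between the images of $D$ and $E$. The $3\to2$ move is the inverse. The configurations (and infinitesimal deformations with zero curvatures) before and after the move are identified by forgetting the length of the edge $DE$, and the form after the move is computed for the new complex with any admissible subset of its edges. *)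

(* Defs.v *)
From HB Require Import structures.
From mathcomp Require Import all_boot all_order all_algebra.
From mathcomp Require Import all_classical all_reals all_analysis.
From mathcomp Require Import ring.
From mathcomp Require mpoly.
(* set0, setT etc. are those of finite sets. *)
From mathcomp Require Import finset.

Set Implicit Arguments.
Unset Strict Implicit.
Unset Printing Implicit Defensive.

Import Order.TTheory GRing.Theory Num.Theory.
Import numFieldNormedType.Exports.

Local Open Scope ring_scope.

Record scomplex (V : finType) := SComplex {
  faces :> {set {set V}};
  faces_neq0 : set0 \notin faces;
  faces_down : forall s t : {set V},
    s \in faces -> t \subset s -> t != set0 -> t \in faces
}.

Section Combinatorics.
Variable V : finType.
Implicit Types (K : scomplex V) (v a b c d e : V).

Definition skel K (n : nat) : {set {set V}} := [set s in faces K | #|s| == n.+1].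
Definition edges K := skel K 1.
Definition triangles K := skel K 2.
Definition tets K := skel K 3.

Definition link K v : {set {set V}} :=
  [set s : {set V} | [&& s != set0, v \notin s & v |: s \in faces K]].

(* [o a b c d] says that the ordered tetrahedron (a, b, c, d) is positively
   oriented; its values outside the tetrahedra of the complex are irrelevant. *)
Definition orientation := V -> V -> V -> V -> bool.

Definition consistent_orientation K (o : orientation) : Prop :=
  (forall a b c d, [set a; b; c; d] \in tets K ->
     [/\ o b a c d = ~~ o a b c d,
         o a c b d = ~~ o a b c d &
         o a b d c = ~~ o a b c d]) /\
  (* two tetrahedra with a common face induce opposite orientations on it *)
  (forall a b c d e, [set a; b; c; d] \in tets K -> [set a; b; c; e] \in tets K ->
     d != e -> o a b c e = ~~ o a b c d).

(* The move replacing abcd, abce by abde, bcde, cade. *)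
Definition move23 K K' a b c d e : Prop :=
  [/\ uniq [:: a; b; c; d; e],
      [set a; b; c; d] \in faces K,
      [set a; b; c; e] \in faces K,
      [set d; e] \notin faces K &
      faces K' =
        (faces K :\: [set [set a; b; c]; [set a; b; c; d]; [set a; b; c; e]])
        :|: [set [set d; e];
                 [set a; d; e]; [set b; d; e]; [set c; d; e];
                 [set a; b; d; e]; [set b; c; d; e]; [set c; a; d; e]]].

(* The move keeps the orientation of the manifold. *)
Definition same_orientation K K' (o o' : orientation) : Prop :=
  forall a b c d, [set a; b; c; d] \in tets K -> [set a; b; c; d] \in tets K' ->
    o a b c d = o' a b c d.

End Combinatorics.

Section PL.
Variable R : realType.

Definition realization (V : finType) (L : {set {set V}}) : set 'rV[R]_#|V| :=
  [set x | [/\ forall v, 0 <= x 0 (enum_rank v),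
               \sum_v x 0 (enum_rank v) = 1 &
               [set v | x 0 (enum_rank v) != 0]%SET \in L]]%classic.

Definition hull n (s : seq 'rV[R]_n) : set 'rV[R]_n :=
  [set x | exists w : 'I_(size s) -> R,
     [/\ forall i, 0 <= w i, \sum_i w i = 1 & x = \sum_i w i *: s`_i]]%classic.

(* A map between compact polyhedra is PL iff its graph is a compact polyhedron,
   i.e. a finite union of convex hulls of finite sets. *)
Definition pl_homeomorphic m n (X : set 'rV[R]_m) (Y : set 'rV[R]_n) : Prop :=
  exists P : seq (seq 'rV[R]_(m + n)),
    let G x y := exists2 s, s \in P & hull s (row_mx x y) in
    [/\ forall x y, G x y -> X x /\ Y y,
        forall x, X x -> exists! y, G x y &
        forall y, Y y -> exists! x, G x y].

(* The boundary of the 3-simplex, as the model PL 2-sphere. *)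
Definition bd_simplex3 : {set {set 'I_4}} := [set s | (s != set0) && (s != setT)].

(* The conditions on facets and on triangles follow from the condition on links;
   they are spelled out because they express purity and closedness. *)
Definition closed_3manifold (V : finType) (K : scomplex V) : Prop :=
  [/\ forall s, s \in faces K -> exists2 t, t \in tets K & s \subset t,
      forall s, s \in triangles K -> #|[set t in tets K | s \subset t]| = 2%N &
      forall v, [set v]%SET \in faces K ->
        pl_homeomorphic (realization (link K v)) (realization bd_simplex3)].

End PL.

Section Geometry.
Variables (R : realType) (V : finType).
Implicit Types (K : scomplex V) (o : orientation V) (p : V -> 'rV[R]_3).
Implicit Types (l : {set V} -> R) (C : {set {set V}}) (a b c d : V).

Definition dot n (u v : 'rV[R]_n) : R := \sum_i u 0 i * v 0 i.
(* The library norm on row vectors is the sup norm. *)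
Definition enorm n (u : 'rV[R]_n) : R := Num.sqrt (dot u u).

Definition det3 (u v w : 'rV[R]_3) : R :=
  \det (\matrix_(i < 3) tnth [tuple u; v; w] i).

Definition sdet p a b c d : R := det3 (p b - p a) (p c - p a) (p d - p a).

Definition vol p (t : {set V}) : R :=
  if enum t is [:: a; b; c; d] then `|sdet p a b c d| / 6 else 0.

Definition len p : {set V} -> R := fun e =>
  if enum e is [:: a; b] then enorm (p b - p a) else 0.

Definition permitted K p : Prop := forall t, t \in tets K -> 0 < vol p t.

(* A length configuration is a function on sets of vertices, of which only the
   values on edges matter.  By the law of cosines, [edot l a b c] is the inner
   product of the vectors ab and ac in a triangle with edge lengths l. *)
Definition edot l a b c : R :=
  (l [set a; b] ^+ 2 + l [set a; c] ^+ 2 - l [set b; c] ^+ 2) / 2.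

(* The interior dihedral angle at the edge ab of a Euclidean tetrahedron abcd
   with edge lengths l: the angle between the components of ac and ad orthogonal
   to ab; see [dihedral_len] below. *)
Definition dihedral l a b c d : R :=
  let orth x y := edot l a x y - edot l a b x * edot l a b y / l [set a; b] ^+ 2 in
  let cc := l [set a; c] ^+ 2 - edot l a b c ^+ 2 / l [set a; b] ^+ 2 in
  let dd := l [set a; d] ^+ 2 - edot l a b d ^+ 2 / l [set a; b] ^+ 2 in
  acos (orth c d / (Num.sqrt cc * Num.sqrt dd)).

(* The angle at the edge j of the tetrahedron t.  For the lengths of an actual
   tetrahedron it does not depend on the enumerations of j and t :\: j. *)
Definition dihedral_at l (j t : {set V}) : R :=
  match enum j, enum (t :\: j) with
  | [:: a; b], [:: c; d] => dihedral l a b c d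
  | _, _ => 0
  end.

(* -1 when the map p preserves the orientation of t, +1 when it reverses it. *)
Definition tet_sign o p (t : {set V}) : R :=
  if enum t is [:: a; b; c; d]
  then (if o a b c d == (0 < sdet p a b c d) then -1 else 1) else 0.

(* A real lift of the defect angle around j, which is defined modulo 2 pi, for
   lengths l near those of p: the signs are those at p, the angles those of l. *)
Definition omega K o p (j : {set V}) l : R :=
  \sum_(t in tets K | j \subset t) tet_sign o p t * dihedral_at l j t.

Definition upd l (k : {set V}) (x : R) : {set V} -> R :=
  fun e => if e == k then x else l e.

Definition domega K o p (j k : {set V}) : R :=
  (fun x : R => omega K o p j (upd (len p) k x))^`()%classic (len p k).

Definition mxon C (a : {set V} -> {set V} -> R) : 'M[R]_#|C| :=
  \matrix_(i, j) a (enum_val i) (enum_val j).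

Definition Amx K o p : 'M[R]_#|edges K| := mxon (edges K) (domega K o p).
Definition fdet K o p C : R := \det (mxon C (domega K o p)).

(* Infinitesimal deformations (dl_k) with all d omega_j = 0; as for lengths,
   only the values on edges matter. *)
Definition zero_curv K o p (v : {set V} -> R) : Prop :=
  forall j, j \in edges K -> \sum_(k in edges K) domega K o p j k * v k = 0.

(* Deformations are column vectors here, so this is the dimension of ker A. *)
Definition zero_curv_dim K o p : nat := \rank (cokermx (Amx K o p)).

Definition placement_coord p (i : 'I_#|{: V * 'I_3}|) : R :=
  p (enum_val i).1 0 (enum_val i).2.

Definition algebraic (Z : set (V -> 'rV[R]_3)) : Prop :=
  exists m (P : 'I_m -> mpoly.mpoly #|{: V * 'I_3}| R),
    forall p, Z p <-> forall i, mpoly.meval (placement_coord p) (P i) = 0.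

Definition generically (Q : (V -> 'rV[R]_3) -> Prop) : Prop :=
  exists Z : set (V -> 'rV[R]_3),
    [/\ algebraic Z, exists p, ~ Z p & forall p, ~ Z p -> Q p].

Definition admissible K o C : Prop :=
  C \subset edges K /\
  generically (fun p => permitted K p ->
    fdet K o p C != 0 /\ #|C| = \rank (Amx K o p)).

(* Value on v_0, ..., v_{n-1} of the wedge product of the n differentials dl_e,
   e in C, taken in the order of [enum C]; meaningful only for n = #|C|. *)
Definition wedge C n (v : 'I_n -> {set V} -> R) : R :=
  \det (\matrix_(i < n, j < n) [seq v i e | e <- enum C]`_j).

Definition form K o C p n (v : 'I_n -> {set V} -> R) : R :=
  `| (\prod_(e in edges K) len p e) * wedge (edges K :\: C) v
     / Num.sqrt (`|fdet K o p C| * \prod_(t in tets K) (6 * vol p t)) |.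

(* Two admissible subsets of edges of one complex. *)
Definition same_form K o C1 C2 : Prop :=
  generically (fun p => permitted K p ->
    let n := zero_curv_dim K o p in
    [/\ #|edges K :\: C1| = n, #|edges K :\: C2| = n &
        forall v : 'I_n -> {set V} -> R, (forall i, zero_curv K o p (v i)) ->
          form K o C1 p v = form K o C2 p v]).

(* K' has the additional edge [k].  The second and third clauses say that forgetting
   the component on [k] is a bijection from the deformations of K' onto those of K. *)
Definition same_form_forget K o C K' o' C' (k : {set V}) : Prop :=
  generically (fun p => permitted K p -> permitted K' p ->
    let n := zero_curv_dim K o p in
    [/\ #|edges K :\: C| = n /\ #|edges K' :\: C'| = n,
        forall v, zero_curv K' o' p v -> zero_curv K o p v,
        forall v, zero_curv K o p v -> exists! x, zero_curv K' o' p (upd v k x) &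
        forall v : 'I_n -> {set V} -> R, (forall i, zero_curv K' o' p (v i)) ->
          form K o C p v = form K' o' C' p v]).

Lemma dotC n (u v : 'rV[R]_n) : dot u v = dot v u.
Proof. by apply: eq_bigr => i _; rewrite mulrC. Qed.

Lemma dotBl n (u v w : 'rV[R]_n) : dot (u - v) w = dot u w - dot v w.
Proof. by rewrite -sumrB; apply: eq_bigr => i _; rewrite !mxE mulrBl. Qed.

Lemma dotBr n (u v w : 'rV[R]_n) : dot w (u - v) = dot w u - dot w v.
Proof. by rewrite !(dotC w) dotBl. Qed.

Lemma dotZl n x (u v : 'rV[R]_n) : dot (x *: u) v = x * dot u v.
Proof. by rewrite mulr_sumr; apply: eq_bigr => i _; rewrite !mxE mulrA. Qed.

Lemma dotZr n x (u v : 'rV[R]_n) : dot u (x *: v) = x * dot u v.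
Proof. by rewrite dotC dotZl dotC. Qed.

Lemma dot_ge0 n (u : 'rV[R]_n) : 0 <= dot u u.
Proof. by apply: sumr_ge0 => i _; rewrite -expr2 sqr_ge0. Qed.

Lemma enorm2 n (u : 'rV[R]_n) : enorm u ^+ 2 = dot u u.
Proof. by rewrite sqr_sqrtr // dot_ge0. Qed.

Lemma enum2 (T : finType) (a b : T) : a != b ->
  enum [set a; b] = [:: a; b] \/ enum [set a; b] = [:: b; a].
Proof.
move=> ab; have sz : size (enum [set a; b]) = 2%N by rewrite -cardE cards2 ab.
have ha : a \in enum [set a; b] by rewrite mem_enum set21.
have hb : b \in enum [set a; b] by rewrite mem_enum set22.
move: sz ha hb; case: (enum _) => [|x [|y [|z s]]] //= _; rewrite !inE.
move=> /orP[] /eqP ea /orP[] /eqP eb; move: ab; rewrite ea eb ?eqxx //; by [left|right].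
Qed.

Lemma len2E p a b : len p [set a; b] ^+ 2 =
  if a == b then 0 else dot (p b - p a) (p b - p a).
Proof.
have [->|ab] := eqVneq a b.
  by rewrite setUid /len enum_set1 expr0n.
rewrite /len; have [->|->] := enum2 ab; rewrite enorm2 // !dotBl !dotBr (dotC (p b)).
ring.
Qed.

Lemma edot_len p a b c : uniq [:: a; b; c] ->
  edot (len p) a b c = dot (p b - p a) (p c - p a).
Proof.
rewrite /= !inE negb_or andbT => /andP[/andP[ab ac] bc].
rewrite /edot !len2E (negbTE ab) (negbTE ac) (negbTE bc) !dotBl !dotBr.
rewrite (dotC (p b) (p a)) (dotC (p c) (p a)) (dotC (p c) (p b)).
by field.
Qed.

Definition angle n (u v : 'rV[R]_n) : R := acos (dot u v / (enorm u * enorm v)).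

Definition orth n (u v : 'rV[R]_n) : 'rV[R]_n := v - (dot u v / dot u u) *: u.

Lemma dot_orth n (u v w : 'rV[R]_n) : dot u u != 0 ->
  dot (orth u v) (orth u w) = dot v w - dot u v * dot u w / dot u u.
Proof.
move=> u0; rewrite /orth !(dotBl, dotBr, dotZl, dotZr) (dotC v u).
by field.
Qed.

Lemma dihedral_len p a b c d : uniq [:: a; b; c; d] -> p a != p b ->
  dihedral (len p) a b c d =
  angle (orth (p b - p a) (p c - p a)) (orth (p b - p a) (p d - p a)).
Proof.
rewrite /= !inE !negb_or andbT => /and3P[/and3P[ab ac ad] /andP[bc bd] cd] pab.
have u0 : dot (p b - p a) (p b - p a) != 0.
  apply: contra_neq pab => /eqP; rewrite psumr_eq0; last first.
    by move=> i _; rewrite -expr2 sqr_ge0.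
  move=> /allP h; apply/rowP => i; have := h i; rewrite mem_index_enum /= => /(_ isT).
  by rewrite !mxE mulf_eq0 orbb subr_eq0 => /eqP.
rewrite /dihedral !edot_len ?len2E /= ?inE ?negb_or ?ab ?ac ?ad ?bc ?bd ?cd //.
rewrite (negbTE ab) (negbTE ac) (negbTE ad) /angle /enorm !dot_orth //.
Qed.

End Geometry.

(* Main.v *)
Require Import Defs.
From mathcomp Require Import all_boot all_order all_algebra.
From mathcomp Require Import all_classical all_reals all_analysis.
From mathcomp Require Import ring.
From mathcomp Require mpoly.
Import (canonicals) mpoly.
From mathcomp Require Import perm finset.

Set Implicit Arguments.
Unset Strict Implicit.
Unset Printing Implicit Defensive.

Import Order.TTheory GRing.Theory Num.Theory.
Import numFieldNormedType.Exports.

Local Open Scope ring_scope.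

(** Write A for the matrix of partial derivatives of the defect angles.

    - Differential of a dihedral angle.  The cosine of the angle at ab in abcd is
      N / sqrt (Pc Pd), where N, Pc, Pd are polynomials in the squared lengths, and
      N^2 + |ab|^2 D^2 = Pc Pd with D = det (ab, ac, ad) ([gram_det3]).  So the
      differential is - (dN - N dPc / 2 Pc - N dPd / 2 Pd) / (|ab| |D|)
      ([is_derive_dihedral]).  Its coefficients are symmetric in each tetrahedron
      ([ddih_opposite], [ddih_adjacent]), hence A is symmetric ([domega_sym]).

    - Choice of C.  Let the rows of W lie in the kernel of the symmetric matrix A.  For
      index sets C and D of the same size, complementary to that of W, the product
      of the matrices [e_C; W] and [A e_D | W^T] is block triangular.  Comparing
      determinants for the four pairs of sets, one finds that |det (A|_C)| is
      proportional to the square of the minor of W on the complement of C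
      ([minor_cominor]).  This is the independence of the form of C.

    - Five points.  Let sum_i lam_i = 0, sum_i lam_i p_i = 0 be the affine dependency
      of five points, with the coefficients lam_i the signed volumes of the opposite
      tetrahedra.  Take the signed sum, over the five tetrahedra of the boundary of
      the 4-simplex, of the matrices of partial derivatives of dihedral angles.  Its
      entry at (ij, kl) is
      (lam_i lam_j l_ij) (lam_k lam_l l_kl) / (lam_1 lam_2 lam_3 lam_4 lam_5)
      ([bd_row_edge]): a matrix of rank one.  For the row xy, only three tetrahedra
      contribute; in their sum, the denominators Pu are eliminated by the relation
      lam_u u + lam_v v + lam_w w = D y (vectors from x), which is Cramer's rule
      ([cramer3], [sum_cyclic_dcos], [sum_sddih]).

    - The move.  The tetrahedra before and after the move form the boundary of the
      4-simplex abcde, and their orientations are related through a tetrahedron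
      outside the move ([move23_outer_tet]).  So A' = A + c s s^T, with s supported on
      the ten edges and |c| = 1 / |lam_1 ... lam_5| ([domega_move23]).  As A vanishes on
      the new edge de, where s does not, a vector is in ker A' iff it is in ker A and
      orthogonal to s; the component on de makes up for the latter condition
      ([zero_curv_move], [zero_curv_extend]).  By a Schur complement,
      det (A'|_(C + de)) = c s_de^2 det (A|_C) ([det_rank1]), and
      |c s_de^2| = l_de^2 V_abcd V_abce / (6 V_abde V_bcde V_cade),
      which is the change of the other factors of the form ([form_move]).

    All this holds at every placement at which the tetrahedra are nondegenerate and both
    sets of edges have the properties required of an admissible set; two generic
    conditions hold together generically ([generically2]). *)

(** * Determinants and inner products in three dimensions *)

Section Euclid.
Variable R : realType.
Implicit Types (u v w y z : 'rV[R]_3).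

Lemma dot3E u v :
  dot u v = u 0 0 * v 0 0 + u 0 1 * v 0 1 + u 0 (inord 2) * v 0 (inord 2).
Proof.
rewrite /dot !big_ord_recr big_ord0 /= add0r.
by congr (_ + _ + _); congr (u 0 _ * v 0 _); apply: val_inj; rewrite /= ?inordK.
Qed.

Lemma det3E u v w : det3 u v w =
  u 0 0 * (v 0 1 * w 0 (inord 2) - v 0 (inord 2) * w 0 1)
  - u 0 1 * (v 0 0 * w 0 (inord 2) - v 0 (inord 2) * w 0 0)
  + u 0 (inord 2) * (v 0 0 * w 0 1 - v 0 1 * w 0 0).
Proof.
pose c (z : 'rV[R]_3) (k : nat) : R := z 0 (inord k).
have cE z (i : 'I_3) : z 0 i = c z i by rewrite /c inord_val.
rewrite /det3 (expand_det_row _ 0) !big_ord_recl big_ord0 /cofactor.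
rewrite !(expand_det_row _ 0) !big_ord_recl !big_ord0 /cofactor !det_mx11 !mxE.
rewrite !(tnth_nth 0) /= !cE /= /bump /= inordK //.
ring.
Qed.

(** With y along the edge, this is sin^2 + cos^2 = 1 for the dihedral angle
    between the half-planes of u and v. *)
Lemma gram_det3 y u v :
  dot y y * det3 y u v ^+ 2 =
  (dot y y * dot u u - dot y u ^+ 2) * (dot y y * dot v v - dot y v ^+ 2)
  - (dot y y * dot u v - dot y u * dot y v) ^+ 2.
Proof. by rewrite det3E !dot3E; ring. Qed.

(** Cramer's rule: y is a combination of u, v, w whose coefficients are quotients of
    determinants. *)
Lemma cramer3 y u v w z :
  det3 y v w * dot u z + det3 y w u * dot v z + det3 y u v * dot w z =
  det3 u v w * dot y z.
Proof. by rewrite !det3E !dot3E; ring. Qed.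

Section Sdet.
Variables (V : finType) (p : V -> 'rV[R]_3).
Implicit Types a b c d : V.

Lemma sdet12 a b c d : sdet p b a c d = - sdet p a b c d.
Proof. by rewrite /sdet !det3E !mxE; ring. Qed.

Lemma sdet23 a b c d : sdet p a c b d = - sdet p a b c d.
Proof. by rewrite /sdet !det3E !mxE; ring. Qed.

Lemma sdet34 a b c d : sdet p a b d c = - sdet p a b c d.
Proof. by rewrite /sdet !det3E !mxE; ring. Qed.

(** The coefficients of the affine dependency of five points add up to zero. *)
Lemma sdet_cocycle a b c d e :
  sdet p b c d e - sdet p a c d e + sdet p a b d e - sdet p a b c e
  + sdet p a b c d = 0.
Proof. by rewrite /sdet !det3E !mxE; ring. Qed.

End Sdet.
End Euclid.

(** Let N be a symmetric form on three vectors u, v, w, with Pu = N(u, u) and so on.  The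
    equations say that au u + av v + aw w is in the kernel of N; they eliminate the
    denominators Pu, Pv, Pw. *)
Lemma sum_cyclic_dcos (F : numFieldType) (au av aw Pu Pv Pw Nuv Nvw Nwu : F)
    (dPu dPv dPw dNuv dNvw dNwu : F) :
  [/\ au != 0, av != 0 & aw != 0] -> [/\ Pu != 0, Pv != 0 & Pw != 0] ->
  au * Pu + av * Nuv + aw * Nwu = 0 ->
  au * Nuv + av * Pv + aw * Nvw = 0 ->
  au * Nwu + av * Nvw + aw * Pw = 0 ->
  (dNuv - Nuv * dPu / (2 * Pu) - Nuv * dPv / (2 * Pv)) / aw
  + (dNvw - Nvw * dPv / (2 * Pv) - Nvw * dPw / (2 * Pw)) / au
  + (dNwu - Nwu * dPw / (2 * Pw) - Nwu * dPu / (2 * Pu)) / av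
  = (au ^+ 2 * dPu + av ^+ 2 * dPv + aw ^+ 2 * dPw
     + 2 * au * av * dNuv + 2 * av * aw * dNvw + 2 * aw * au * dNwu)
    / (2 * au * av * aw).
Proof.
move=> [au0 av0 aw0] [Pu0 Pv0 Pw0] hu hv hw.
transitivity (dNuv / aw + dNvw / au + dNwu / av
  - dPu / (2 * Pu) * (av * Nuv + aw * Nwu) / (av * aw)
  - dPv / (2 * Pv) * (au * Nuv + aw * Nvw) / (au * aw)
  - dPw / (2 * Pw) * (au * Nwu + av * Nvw) / (au * av)).
  by field; do !(apply/andP; split).
have -> : av * Nuv + aw * Nwu = - (au * Pu).
  by apply/eqP; rewrite -subr_eq0 -hu; apply/eqP; ring.
have -> : au * Nuv + aw * Nvw = - (av * Pv).
  by apply/eqP; rewrite -subr_eq0 -hv; apply/eqP; ring.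
have -> : au * Nwu + av * Nvw = - (aw * Pw).
  by apply/eqP; rewrite -subr_eq0 -hw; apply/eqP; ring.
by field; do !(apply/andP; split).
Qed.

(** * Differentials of dihedral angles and five points in space *)

Section DihedralDerivative.
Variables (R : realType) (V : finType) (p : V -> 'rV[R]_3).
Implicit Types (m : {set V} -> R) (a b c d u v w x y : V).

Let l := len p.

(** Differential of [edot] in the direction [m]. *)
Definition dedot m a b c : R :=
  l [set a; b] * m [set a; b] + l [set a; c] * m [set a; c]
  - l [set b; c] * m [set b; c].

(** The inner product of the components of ac and ad orthogonal to ab, times
    |ab|^2; [gramsq] is the case c = d. *)
Definition gram a b c d : R :=
  l [set a; b] ^+ 2 * edot l a c d - edot l a b c * edot l a b d.
Definition gramsq a b c : R :=
  l [set a; b] ^+ 2 * l [set a; c] ^+ 2 - edot l a b c ^+ 2.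

(** The differentials of [gram] and [gramsq] in the direction [m]. *)
Definition dgram m a b c d : R :=
  2 * (l [set a; b] * m [set a; b]) * edot l a c d
  + l [set a; b] ^+ 2 * dedot m a c d
  - dedot m a b c * edot l a b d - edot l a b c * dedot m a b d.
Definition dgramsq m a b c : R :=
  2 * (l [set a; b] * m [set a; b]) * l [set a; c] ^+ 2
  + l [set a; b] ^+ 2 * (2 * (l [set a; c] * m [set a; c]))
  - 2 * edot l a b c * dedot m a b c.

(** sqrt (Pc Pd) times the differential of N / sqrt (Pc Pd), the cosine of the
    dihedral angle at ab, where N, Pc, Pd are [gram] and the two [gramsq]. *)
Definition dcos m a b c d : R :=
  dgram m a b c d
  - gram a b c d * dgramsq m a b c / (2 * gramsq a b c)
  - gram a b c d * dgramsq m a b d / (2 * gramsq a b d).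

(** The differential of the dihedral angle at ab; see [is_derive_dihedral]. *)
Definition ddih m a b c d : R :=
  - dcos m a b c d / (l [set a; b] * `|sdet p a b c d|).

(** The differential of the dihedral angle at ab, taken with the sign of the
    orientation of abcd. *)
Definition sddih m a b c d : R :=
  - dcos m a b c d / (l [set a; b] * sdet p a b c d).

Lemma sddihE m a b c d :
  sddih m a b c d = Num.sg (sdet p a b c d) * ddih m a b c d.
Proof.
rewrite /sddih /ddih; have [->|s0] := eqVneq (sdet p a b c d) 0.
  by rewrite sgr0 !mul0r mulr0 invr0 mulr0.
rewrite [in LHS](numEsg (sdet p a b c d)) !invfM invr_sg; ring.
Qed.

(** The linear form with coefficient lam_x lam_y l_xy on the length of the edge xy,
    where lam is the affine dependency between the five points, normalized to the
    signed volumes (times 6) of the opposite tetrahedra. *)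
Definition stress m a b c d e : R :=
  let la := sdet p b c d e in let lb := - sdet p a c d e in
  let lc := sdet p a b d e in let ld := - sdet p a b c e in
  let le := sdet p a b c d in
  let n x y := l [set x; y] * m [set x; y] in
  la * lb * n a b + la * lc * n a c + la * ld * n a d + la * le * n a e
  + lb * lc * n b c + lb * ld * n b d + lb * le * n b e
  + lc * ld * n c d + lc * le * n c e + ld * le * n d e.

Lemma gramsq_det x y u v : uniq [:: x; y; u; v] ->
  l [set x; y] ^+ 2 * sdet p x y u v ^+ 2 =
  gramsq x y u * gramsq x y v - gram x y u v ^+ 2.
Proof.
move=> U; have := U; rewrite /= !inE !negb_or andbT.
move=> /and3P[/and3P[xy xu xv] /andP[yu yv] uv].
rewrite /gramsq /gram !edot_len /= ?inE ?negb_or ?xy ?xu ?xv ?yu ?yv ?uv //.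
by rewrite !len2E (negbTE xy) (negbTE xu) (negbTE xv); apply: gram_det3.
Qed.

Lemma len_gt0 x y u v : uniq [:: x; y; u; v] -> sdet p x y u v != 0 ->
  0 < l [set x; y].
Proof.
move=> U D0; have l0 : 0 <= l [set x; y].
  by rewrite /l /len; case: (enum _) => [|? [|? [|? ?]]] //; apply: sqrtr_ge0.
rewrite lt0r l0 andbT; apply: contraNneq D0 => l00.
have : l [set x; y] ^+ 2 = 0 by rewrite l00 expr0n.
have xy : x != y by move: U; rewrite /= !inE !negb_or => /andP[/andP[]].
rewrite len2E (negbTE xy) dot3E => h.
have : (p y - p x) 0 0 ^+ 2 + (p y - p x) 0 1 ^+ 2
       + (p y - p x) 0 (inord 2) ^+ 2 = 0 by rewrite -h !expr2.
move/eqP; rewrite !paddr_eq0 ?addr_ge0 ?sqr_ge0 // !sqrf_eq0.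
move=> /andP[/andP[/eqP h0 /eqP h1] /eqP h2].
by rewrite /sdet det3E h0 h1 h2 !mul0r subr0 addr0.
Qed.

(** No face of a nondegenerate tetrahedron is degenerate. *)
Lemma gramsq_gt0 x y u v : uniq [:: x; y; u; v] -> sdet p x y u v != 0 ->
  0 < gramsq x y u.
Proof.
move=> U D0; have l0 := len_gt0 U D0.
have h : 0 < gramsq x y u * gramsq x y v.
  rewrite -[ltRHS](subrK (gram x y u v ^+ 2)) -gramsq_det //.
  apply: ltr_wpDr; first exact: sqr_ge0.
  apply: mulr_gt0; first exact: exprn_gt0.
  by rewrite lt0r sqr_ge0 sqrf_eq0 D0.
have g0 : 0 <= gramsq x y u.
  have : 0 <= dot (orth (p y - p x) (p u - p x)) (orth (p y - p x) (p u - p x)).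
    exact: dot_ge0.
  move: U; rewrite /= !inE !negb_or andbT.
  move=> /and3P[/and3P[xy xu xv] /andP[yu yv] uv].
  have e : dot (p y - p x) (p y - p x) = l [set x; y] ^+ 2.
    by rewrite len2E (negbTE xy).
  rewrite dot_orth e ?expf_neq0 ?gt_eqF // => h0.
  have -> : gramsq x y u = l [set x; y] ^+ 2 *
     (dot (p u - p x) (p u - p x) - dot (p y - p x) (p u - p x) *
       dot (p y - p x) (p u - p x) / l [set x; y] ^+ 2).
    rewrite /gramsq edot_len /= ?inE ?negb_or ?xy ?xu ?yu //.
    rewrite [l [set x; u] ^+ 2]len2E (negbTE xu); field.
    by rewrite gt_eqF.
  by rewrite mulr_ge0 // exprn_ge0 // ltW.
rewrite lt0r g0 andbT; apply: contraTneq h => ->; by rewrite mul0r ltxx.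
Qed.

(** The three tetrahedra at the edge xy, one for each pair of the remaining points,
    contribute to the row xy. *)
Lemma sum_sddih m x y u v w : uniq [:: x; y; u; v; w] ->
  [/\ sdet p x y v w != 0, sdet p x y w u != 0 & sdet p x y u v != 0] ->
  sddih m x y u v + sddih m x y v w + sddih m x y w u =
  l [set x; y] * stress m x y u v w
  / (sdet p x y v w * sdet p x y w u * sdet p x y u v).
Proof.
move=> U [Du0 Dv0 Dw0].
have : uniq [:: x; y; u; v; w] by [].
rewrite /= !inE !negb_or andbT.
move=> /and4P[/and4P[xy xu xv xw] /and3P[yu yv yw] /andP[uv uw] vw].
have vu := uv; rewrite eq_sym in vu.
have wu := uw; rewrite eq_sym in wu.
have wv := vw; rewrite eq_sym in wv.
have Uuv : uniq [:: x; y; u; v].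
  by rewrite /= !inE !negb_or ?xy ?xu ?xv ?xw ?yu ?yv ?yw ?uv ?uw ?vw.
have Uvw : uniq [:: x; y; v; w].
  by rewrite /= !inE !negb_or ?xy ?xu ?xv ?xw ?yu ?yv ?yw ?uv ?uw ?vw.
have Uwu : uniq [:: x; y; w; u].
  by rewrite /= !inE !negb_or ?xy ?xu ?xv ?xw ?yu ?yv ?yw ?wu ?uw ?vw.
have l0 := len_gt0 Uuv Dw0.
have Pu0 := gramsq_gt0 Uuv Dw0; have Pv0 := gramsq_gt0 Uvw Du0.
have Pw0 := gramsq_gt0 Uwu Dv0.
set au := sdet p x y v w in Du0 *; set av := sdet p x y w u in Dv0 *.
set aw := sdet p x y u v in Dw0 *; pose D := sdet p x u v w.
set Y := p y - p x; set U' := p u - p x; set V' := p v - p x; set W' := p w - p x.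
have cr z : au * dot U' z + av * dot V' z + aw * dot W' z = D * dot Y z.
  exact: cramer3.
have lyy : l [set x; y] ^+ 2 = dot Y Y by rewrite len2E (negbTE xy).
have luu : l [set x; u] ^+ 2 = dot U' U' by rewrite len2E (negbTE xu).
have lvv : l [set x; v] ^+ 2 = dot V' V' by rewrite len2E (negbTE xv).
have lww : l [set x; w] ^+ 2 = dot W' W' by rewrite len2E (negbTE xw).
have eyu : edot l x y u = dot Y U' by apply: edot_len; rewrite /= !inE negb_or xy xu yu.
have eyv : edot l x y v = dot Y V' by apply: edot_len; rewrite /= !inE negb_or xy xv yv.
have eyw : edot l x y w = dot Y W' by apply: edot_len; rewrite /= !inE negb_or xy xw yw.
have euv : edot l x u v = dot U' V' by apply: edot_len; rewrite /= !inE negb_or xu xv uv.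
have evw : edot l x v w = dot V' W' by apply: edot_len; rewrite /= !inE negb_or xv xw vw.
have ewu : edot l x w u = dot W' U' by apply: edot_len; rewrite /= !inE negb_or xw xu wu.
have hy := cr Y; have hu := cr U'; have hv := cr V'; have hw := cr W'.
rewrite !(dotC _ Y) in hy hu hv hw.
rewrite (dotC V' U') (dotC U' W') in hu hv hw.
rewrite (dotC W' V') in hu hv hw.
move: eyu eyv eyw euv evw ewu lyy luu lvv lww hy hu hv hw.
have la : sdet p y u v w = D - (au + av + aw).
  rewrite /D /au /av /aw -[LHS](subr0) -(sdet_cocycle p x y u v w).
  rewrite (sdet34 p x y u w); ring.
rewrite {cr}; move: (dot Y Y) (dot Y U') (dot Y V') (dot Y W') => yy' yu' yv' yw'.
move: (dot U' U') (dot V' V') (dot W' W') (dot U' V') (dot V' W') (dot W' U').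
move=> uu' vv' ww' uv' vw' wu' eyu eyv eyw euv evw ewu lyy luu lvv lww hy hu hv hw.
have Nuv : gram x y u v = yy' * uv' - yu' * yv' by rewrite /gram lyy euv eyu eyv.
have Nvw : gram x y v w = yy' * vw' - yv' * yw' by rewrite /gram lyy evw eyv eyw.
have Nwu : gram x y w u = yy' * wu' - yw' * yu' by rewrite /gram lyy ewu eyu eyw.
have Pu : gramsq x y u = yy' * uu' - yu' ^+ 2 by rewrite /gramsq lyy luu eyu.
have Pv : gramsq x y v = yy' * vv' - yv' ^+ 2 by rewrite /gramsq lyy lvv eyv.
have Pw : gramsq x y w = yy' * ww' - yw' ^+ 2 by rewrite /gramsq lyy lww eyw.
have -> : sddih m x y u v + sddih m x y v w + sddih m x y w u =
  - (l [set x; y])^-1 *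
  (dcos m x y u v / aw + dcos m x y v w / au + dcos m x y w u / av).
  rewrite /sddih -/au -/av -/aw; field.
  by do !(apply/andP; split) => //; rewrite ?gt_eqF.
rewrite /dcos (@sum_cyclic_dcos R au av aw); last first.
- apply/eqP; rewrite -(subr0 (_ + _)) -[X in _ - X](subrr (yy' * (D * yw') - yw' * (D * yy'))).
  rewrite -{1}hw -{1}hy Nwu Nvw Pw; apply/eqP; ring.
- apply/eqP; rewrite -(subr0 (_ + _)) -[X in _ - X](subrr (yy' * (D * yv') - yv' * (D * yy'))).
  rewrite -{1}hv -{1}hy Nuv Nvw Pv; apply/eqP; ring.
- apply/eqP; rewrite -(subr0 (_ + _)) -[X in _ - X](subrr (yy' * (D * yu') - yu' * (D * yy'))).
  rewrite -{1}hu -{1}hy Nwu Nuv Pu; apply/eqP; ring.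
- by rewrite !gt_eqF.
- by [].
set Q := (X in _ * (X / _)).
(* the squared length of au U' + av V' + aw W' = D Y *)
have sq : au ^+ 2 * uu' + av ^+ 2 * vv' + aw ^+ 2 * ww' + 2 * au * av * uv'
          + 2 * av * aw * vw' + 2 * aw * au * wu' = D * (D * yy').
  rewrite -hy; transitivity (au * (D * yu') + av * (D * yv') + aw * (D * yw')).
    by rewrite -hu -hv -hw; ring.
  by ring.
suff -> : Q = - 2 * yy' * stress m x y u v w.
  by rewrite -lyy; field; do !(apply/andP; split) => //; rewrite gt_eqF.
rewrite /stress /= -/au -/aw la -/D (sdet34 p x y w u) -/av opprK.
rewrite /Q /dgram /dgramsq /dedot euv evw ewu lyy luu lvv lww eyu eyv eyw.
rewrite ![[set w; u]]setUC.
move: (l [set x; y] * _) (l [set x; u] * _) (l [set x; v] * _) (l [set x; w] * _).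
move: (l [set y; u] * _) (l [set y; v] * _) (l [set y; w] * _).
move: (l [set u; v] * _) (l [set u; w] * _) (l [set v; w] * _).
move=> nuv nuw nvw nyu nyv nyw nxy nxu nxv nxw.
(* Q is the differential of yy |z|^2 - (y . z)^2 for z = au U' + av V' + aw W' = D Y,
   with the coefficients au, av, aw kept constant *)
transitivity (2 * nxy * (D * (D * yy'))
  + yy' * (2 * au ^+ 2 * nxu + 2 * av ^+ 2 * nxv + 2 * aw ^+ 2 * nxw
    + 2 * au * av * (nxu + nxv - nuv) + 2 * av * aw * (nxv + nxw - nvw)
    + 2 * aw * au * (nxw + nxu - nuw))
  - 2 * (D * yy') * (au * (nxy + nxu - nyu) + av * (nxy + nxv - nyv)
    + aw * (nxy + nxw - nyw))); last by ring.
by rewrite -sq -hy; ring.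
Qed.

End DihedralDerivative.

(** * The derivative of a dihedral angle *)

Section Derive.
Variables (R : realType).
Implicit Types (f g : R -> R) (x df dg : R).

Lemma is_deriveDf f g x df dg : is_derive x 1 f df -> is_derive x 1 g dg ->
  is_derive x 1 (fun y => f y + g y) (df + dg).
Proof. exact: is_deriveD. Qed.

Lemma is_deriveBf f g x df dg : is_derive x 1 f df -> is_derive x 1 g dg ->
  is_derive x 1 (fun y => f y - g y) (df - dg).
Proof. exact: is_deriveB. Qed.

Lemma is_deriveMf f g x df dg : is_derive x 1 f df -> is_derive x 1 g dg ->
  is_derive x 1 (fun y => f y * g y) (df * g x + f x * dg).
Proof.
move=> hf hg; have h := is_deriveM hf hg.
by apply: (is_derive_eq h); rewrite addrC; congr (_ + _); apply: mulrC.
Qed.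

Lemma is_deriveX2f f x df : is_derive x 1 f df ->
  is_derive x 1 (fun y => f y ^+ 2) (2 * (f x * df)).
Proof. by move=> hf; apply: (is_derive_eq (is_deriveMf hf hf)); ring. Qed.

Lemma is_deriveVf f x df : f x != 0 -> is_derive x 1 f df ->
  is_derive x 1 (fun y => (f y)^-1) (- df / f x ^+ 2).
Proof.
move=> f0 hf; apply: (is_derive_eq (is_deriveV f0 hf)).
by rewrite /GRing.scale /= mulrC mulrN mulNr.
Qed.

Lemma is_derive_divf f g x df dg : g x != 0 ->
  is_derive x 1 f df -> is_derive x 1 g dg ->
  is_derive x 1 (fun y => f y / g y) (df / g x - f x * dg / g x ^+ 2).
Proof.
move=> g0 hf hg; apply: (is_derive_eq (is_deriveMf hf (is_deriveVf g0 hg))).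
by field.
Qed.

Lemma is_derive_sqrtf f x df : 0 < f x -> is_derive x 1 f df ->
  is_derive x 1 (fun y => Num.sqrt (f y)) (df / (2 * Num.sqrt (f x))).
Proof.
move=> f0 hf; have h := is_derive1_comp (is_derive1_sqrt f0) hf.
by apply: (is_derive_eq h); rewrite mulrC.
Qed.

Lemma is_derive_acosf f x df : -1 < f x < 1 -> is_derive x 1 f df ->
  is_derive x 1 (fun y => acos (f y)) (- df / Num.sqrt (1 - f x ^+ 2)).
Proof.
move=> f0 hf; have h := is_derive1_comp (is_derive1_acos f0) hf.
by apply: (is_derive_eq h); rewrite mulNr mulrC mulNr.
Qed.

Lemma is_derive_sumf (I : Type) (r : seq I) (P : pred I) (f : I -> R -> R)
    (df : I -> R) x :
  (forall i, P i -> is_derive x 1 (f i) (df i)) ->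
  is_derive x 1 (fun y => \sum_(i <- r | P i) f i y) (\sum_(i <- r | P i) df i).
Proof.
move=> h; elim: r => [|i r ih].
  rewrite big_nil; under eq_fun do rewrite big_nil; exact: is_derive_cst.
rewrite big_cons; under eq_fun do rewrite big_cons.
by case: ifP => // Pi; apply: is_deriveDf => //; apply: h.
Qed.

(** The derivative of an angle given by its cosine o / sqrt (c d). *)
Lemma is_derive_acos_ratio (o c d : R -> R) x do_ dc dd (g : R) :
  0 < c x -> 0 < d x -> 0 < g -> g ^+ 2 = c x * d x - o x ^+ 2 ->
  is_derive x 1 o do_ -> is_derive x 1 c dc -> is_derive x 1 d dd ->
  is_derive x 1 (fun y => acos (o y / (Num.sqrt (c y) * Num.sqrt (d y))))
    (- (do_ - o x * dc / (2 * c x) - o x * dd / (2 * d x)) / g).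
Proof.
move=> c0 d0 g0 hg ho hc hd.
have sc0 : 0 < Num.sqrt (c x) by rewrite sqrtr_gt0.
have sd0 : 0 < Num.sqrt (d x) by rewrite sqrtr_gt0.
have hs := is_deriveMf (is_derive_sqrtf c0 hc) (is_derive_sqrtf d0 hd).
have s0 : Num.sqrt (c x) * Num.sqrt (d x) != 0 by rewrite mulf_neq0 ?gt_eqF.
have hq := @is_derive_divf o (fun y => Num.sqrt (c y) * Num.sqrt (d y)) x _ _
  s0 ho hs.
set C := Num.sqrt (c x) in sc0 s0 hs hq; set D := Num.sqrt (d x) in sd0 s0 hs hq.
have ec : c x = C ^+ 2 by rewrite sqr_sqrtr // ltW.
have ed : d x = D ^+ 2 by rewrite sqr_sqrtr // ltW.
have e1 : 1 - (o x / (C * D)) ^+ 2 = (g / (C * D)) ^+ 2.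
  have -> : 1 - (o x / (C * D)) ^+ 2 = (C ^+ 2 * D ^+ 2 - o x ^+ 2) / (C * D) ^+ 2.
    by field; rewrite !gt_eqF.
  by rewrite -ec -ed -hg expr_div_n.
have gp : 0 < g / (C * D) by rewrite divr_gt0 // mulr_gt0.
have rng : -1 < o x / (C * D) < 1.
  rewrite -ltr_norml -(expr_lt1 (isT : (0 < 2)%N)) //.
  by rewrite real_normK ?num_real // -subr_gt0 e1 exprn_gt0.
have h := @is_derive_acosf (fun y => o y / (Num.sqrt (c y) * Num.sqrt (d y))) x _
  rng hq.
apply: (is_derive_eq h).
rewrite e1 sqrtr_sqr gtr0_norm // -/C -/D ec ed.
by field; rewrite !gt_eqF.
Qed.
End Derive.

Section DihedralIsDerive.
Variables (R : realType) (V : finType) (p : V -> 'rV[R]_3).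
Implicit Types (k : {set V}) (a b c d : V).

Let l := len p.

(** The deformation changing the length of the edge [k] alone, at unit speed. *)
Definition unit_dl k (e : {set V}) : R := (e == k)%:R.

Lemma is_derive_upd k e : is_derive (l k) 1 (fun x => upd l k x e) (unit_dl k e).
Proof.
rewrite /upd /unit_dl; case: eqP => _; first exact: is_derive_id.
exact: is_derive_cst.
Qed.

Lemma is_derive_edot k a b c :
  is_derive (l k) 1 (fun x => edot (upd l k x) a b c) (dedot p (unit_dl k) a b c).
Proof.
rewrite /edot /dedot.
have h e := is_deriveX2f (is_derive_upd k e).
have := is_deriveBf (is_deriveDf (h [set a; b]) (h [set a; c])) (h [set b; c]).
move=> /(fun h' => is_deriveMf h' (is_derive_cst (2^-1 : R) (l k) 1)) h'.
apply: (is_derive_eq h').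
have u e : upd l k (l k) e = l e by rewrite /upd; case: eqP => // ->.
rewrite /= !u mulr0 addr0 -/l.
by field.
Qed.

(** The partial derivative in the length of [k], which need not be an edge of abcd. *)
Lemma is_derive_dihedral k a b c d :
  uniq [:: a; b; c; d] -> sdet p a b c d != 0 ->
  is_derive (l k) 1 (fun x => dihedral (upd l k x) a b c d)
    (ddih p (unit_dl k) a b c d).
Proof.
move=> U D0; have U' : uniq [:: a; b; d; c].
  by move: U; rewrite /= !inE !negb_or (eq_sym c d) => /and4P[/and3P[-> -> ->] /andP[-> ->] -> _].
have l0 := len_gt0 U D0; have Pc0 := gramsq_gt0 U D0.
have D0' : sdet p a b d c != 0 by rewrite sdet34 oppr_eq0.
have Pd0 := gramsq_gt0 U' D0'.
have u e : upd l k (l k) e = l e by rewrite /upd; case: eqP => // ->.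
have hX e := is_deriveX2f (is_derive_upd k e).
have hE x y z := is_derive_edot k x y z.
have uu : upd l k (l k) = l by apply: funext => e; apply: u.
have L2 : upd l k (l k) [set a; b] ^+ 2 != 0 by rewrite u expf_neq0 // gt_eqF.
have L0 : l [set a; b] != 0 by rewrite gt_eqF.
have ho := is_deriveBf (hE a c d)
   (@is_derive_divf R _ (fun x => upd l k x [set a; b] ^+ 2) _ _ _ L2
      (is_deriveMf (hE a b c) (hE a b d)) (hX [set a; b])).
have hc := is_deriveBf (hX [set a; c])
   (@is_derive_divf R _ (fun x => upd l k x [set a; b] ^+ 2) _ _ _ L2
      (is_deriveX2f (hE a b c)) (hX [set a; b])).
have hd := is_deriveBf (hX [set a; d])
   (@is_derive_divf R _ (fun x => upd l k x [set a; b] ^+ 2) _ _ _ L2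
      (is_deriveX2f (hE a b d)) (hX [set a; b])).
rewrite /dihedral.
have c0 : l [set a; c] ^+ 2 - edot l a b c ^+ 2 / l [set a; b] ^+ 2
          = gramsq p a b c / l [set a; b] ^+ 2.
  by rewrite /gramsq -/l; field.
have d0 : l [set a; d] ^+ 2 - edot l a b d ^+ 2 / l [set a; b] ^+ 2
          = gramsq p a b d / l [set a; b] ^+ 2.
  by rewrite /gramsq -/l; field.
have o0 : edot l a c d - edot l a b c * edot l a b d / l [set a; b] ^+ 2
          = gram p a b c d / l [set a; b] ^+ 2.
  by rewrite /gram -/l; field.
have := @is_derive_acos_ratio R _ _ _ (l k) _ _ _
  (`|sdet p a b c d| / l [set a; b]) _ _ _ _ ho hc hd.
rewrite /= !uu c0 d0 o0.
rewrite !divr_gt0 ?exprn_gt0 ?normr_gt0 // => /(_ isT isT isT) h.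
have {}h := h _; apply: (is_derive_eq (h _)).
  have := gramsq_det p U; rewrite -/l => e.
  rewrite expr_div_n real_normK ?num_real //.
  have -> : sdet p a b c d ^+ 2 =
      (gramsq p a b c * gramsq p a b d - gram p a b c d ^+ 2) / l [set a; b] ^+ 2.
    by rewrite -e; field.
  by field.
rewrite /ddih /dcos /dgram /dgramsq -/l.
have ng : `|sdet p a b c d| != 0 by rewrite normr_eq0.
have gc : gramsq p a b c != 0 by rewrite gt_eqF.
have gd : gramsq p a b d != 0 by rewrite gt_eqF.
move: ng gc gd; rewrite /gram /gramsq -/l => ng gc gd.
rewrite -exprMn in gc; rewrite -exprMn in gd.
by field; apply/and4P; split.
Qed.
End DihedralIsDerive.

(** * Labellings of four-element sets *)

Section Labellings.
Variable V : finType.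
Implicit Types (a b c d x y z w : V) (j t : {set V}).

Lemma card_set4 a b c d : (#|[set a; b; c; d]| == 4) = uniq [:: a; b; c; d].
Proof.
have -> : #|[set a; b; c; d]| = #|[:: a; b; c; d]|.
  by apply: eq_card => x; rewrite !inE -!orbA.
by apply/eqP/idP => [/card_uniqP//|/card_uniqP ->].
Qed.

Lemma uniq4 a b c d : uniq [:: a; b; c; d] ->
  [/\ [/\ a != b, a != c & a != d], b != c /\ b != d & c != d].
Proof.
by rewrite /= !inE !negb_or andbT => /and3P[/and3P[-> -> ->] /andP[-> ->] ->].
Qed.

Lemma set4_swap12 a b c d : [set b; a; c; d] = [set a; b; c; d].
Proof. by rewrite (setUC [set b]). Qed.

Lemma set4_swap23 a b c d : [set a; c; b; d] = [set a; b; c; d].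
Proof. by rewrite (setUAC [set a] [set c]). Qed.

Lemma set4_swap34 a b c d : [set a; b; d; c] = [set a; b; c; d].
Proof. by rewrite setUAC. Qed.

(** Adjacent transpositions relate any two labellings of a 4-element set. *)
Lemma labelling4_ind t (P : V -> V -> V -> V -> Prop) a b c d :
  (forall a b c d, [set a; b; c; d] = t -> P a b c d ->
     [/\ P b a c d, P a c b d & P a b d c]) ->
  [set a; b; c; d] = t -> P a b c d ->
  forall x y z w, uniq [:: x; y; z; w] -> [set x; y; z; w] = t -> P x y z w.
Proof.
move=> sw et Pt x y z w U ext.
pose Q a b c d := [set a; b; c; d] = t /\ P a b c d.
have s12 a' b' c' d' : Q a' b' c' d' -> Q b' a' c' d'.
  by case=> e h; split; [rewrite set4_swap12 | case: (sw _ _ _ _ e h)].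
have s23 a' b' c' d' : Q a' b' c' d' -> Q a' c' b' d'.
  by case=> e h; split; [rewrite set4_swap23 | case: (sw _ _ _ _ e h)].
have s34 a' b' c' d' : Q a' b' c' d' -> Q a' b' d' c'.
  by case=> e h; split; [rewrite set4_swap34 | case: (sw _ _ _ _ e h)].
have Q0 : Q a b c d by [].
move: U; rewrite /= !inE !negb_or andbT => /and3P[/and3P[xy xz xw] /andP[yz yw] zw].
have [xt yt zt wt] : [/\ x \in t, y \in t, z \in t & w \in t].
  by rewrite -ext; split; rewrite !inE eqxx ?orbT.
have [b1 [c1 [d1 Q1]]] : exists b' c' d', Q x b' c' d'.
  move: xt; rewrite -et !inE -!orbA => /or4P[] /eqP->; do 3 eexists.
  - exact: Q0.
  - exact: (s12 _ _ _ _ Q0).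
  - exact: (s12 _ _ _ _ (s23 _ _ _ _ Q0)).
  - exact: (s12 _ _ _ _ (s23 _ _ _ _ (s34 _ _ _ _ Q0))).
have [c2 [d2 Q2]] : exists c' d', Q x y c' d'.
  move: yt; rewrite -(proj1 Q1) !inE -!orbA eq_sym (negbTE xy) /= => /or3P[] /eqP ->;
    do 2 eexists.
  - exact: Q1.
  - exact: (s23 _ _ _ _ Q1).
  - exact: (s23 _ _ _ _ (s34 _ _ _ _ Q1)).
have [d3 Q3] : exists d', Q x y z d'.
  move: zt; rewrite -(proj1 Q2) !inE -!orbA eq_sym (negbTE xz) eq_sym (negbTE yz) /=.
  by move=> /orP[] /eqP ->; eexists; [exact: Q2 | exact: (s34 _ _ _ _ Q2)].
move: wt; rewrite -(proj1 Q3) !inE -!orbA.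
rewrite !(eq_sym w) (negbTE xw) (negbTE yw) (negbTE zw) /= => /eqP e.
by move: Q3; rewrite e => -[].
Qed.

Lemma edge_tet_labelling j t : #|j| = 2%N -> #|t| = 4%N -> j \subset t ->
  exists a b c d,
    [/\ uniq [:: a; b; c; d], j = [set a; b] & t = [set a; b; c; d]].
Proof.
move=> j2 t4 jt.
have /cards2P[a [b [ab ej]]] : #|j| == 2%N by apply/eqP.
have /cards2P[c [d [cd ec]]] : #|t :\: j| == 2%N.
  by rewrite cardsD (setIidPr jt) t4 j2.
have et : t = [set a; b; c; d].
  by rewrite -setUA -ej -ec -[LHS](setID t j) (setIidPr jt).
by exists a, b, c, d; split=> //; rewrite -card_set4 -et t4.
Qed.

Lemma set2_neql a b x y : x != a -> x != b -> ([set x; y] == [set a; b]) = false.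
Proof.
move=> xa xb; apply/eqP => /setP /(_ x).
by rewrite !inE eqxx (negbTE xa) (negbTE xb).
Qed.

Lemma set2_neqr a b x y : y != a -> y != b -> ([set x; y] == [set a; b]) = false.
Proof. by rewrite setUC; apply: set2_neql. Qed.

End Labellings.

(** * One tetrahedron: symmetry, volume, sign *)

Section Tetrahedron.
Variables (R : realType) (V : finType) (p : V -> 'rV[R]_3).
Implicit Types (a b c d x y z w : V) (j k t : {set V}) (m : {set V} -> R).

Let l := len p.

Lemma edotC a b c : edot l a c b = edot l a b c.
Proof. by rewrite /edot (setUC [set c]); field. Qed.

Lemma dedotC m a b c : dedot p m a c b = dedot p m a b c.
Proof. by rewrite /dedot (setUC [set c]); ring. Qed.

Lemma dcos_swap34 m a b c d : dcos p m a b d c = dcos p m a b c d.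
Proof.
rewrite /dcos.
have -> : gram p a b d c = gram p a b c d.
  by rewrite /gram -/l (edotC a c d); ring.
have -> : dgram p m a b d c = dgram p m a b c d.
  by rewrite /dgram -/l (edotC a c d) (dedotC m a c d); ring.
by ring.
Qed.

Lemma dcos_swap12 m a b c d : dcos p m b a c d = dcos p m a b c d.
Proof.
have e1 x : gramsq p b a x = gramsq p a b x.
  by rewrite /gramsq /edot (setUC [set b] [set a]); field.
have e2 x : dgramsq p m b a x = dgramsq p m a b x.
  by rewrite /dgramsq /edot /dedot (setUC [set b] [set a]); field.
have -> : dcos p m b a c d = dgram p m b a c d
  - gram p b a c d * dgramsq p m b a c / (2 * gramsq p b a c)
  - gram p b a c d * dgramsq p m b a d / (2 * gramsq p b a d) by [].
rewrite !e1 !e2.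
have -> : gram p b a c d = gram p a b c d.
  by rewrite /gram /edot (setUC [set b] [set a]); field.
have -> // : dgram p m b a c d = dgram p m a b c d.
by rewrite /dgram /edot /dedot (setUC [set b] [set a]); field.
Qed.

Lemma ddih_swap34 m a b c d : ddih p m a b d c = ddih p m a b c d.
Proof. by rewrite /ddih dcos_swap34 sdet34 normrN. Qed.

Lemma ddih_swap12 m a b c d : ddih p m b a c d = ddih p m a b c d.
Proof. by rewrite /ddih dcos_swap12 sdet12 normrN (setUC [set b]). Qed.

(** The matrix of partial derivatives of the dihedral angles of a tetrahedron is
    symmetric: entries for two opposite edges, then for two adjacent ones. *)
Lemma ddih_opposite a b c d : uniq [:: a; b; c; d] ->
  ddih p (unit_dl R [set c; d]) a b c d = ddih p (unit_dl R [set a; b]) c d a b.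
Proof.
move=> U; have [[ab ac ad] [bc bd] cd] := uniq4 U.
have sd : sdet p c d a b = sdet p a b c d.
  by rewrite (sdet23 p c a) (sdet12 p a c) (sdet34 p a c) (sdet23 p a b) !opprK.
rewrite /ddih /dcos /dgram /dgramsq /dedot /unit_dl sd -/l eqxx.
have -> : ([set a; b] == [set c; d]) = false by rewrite set2_neql.
have -> : ([set a; c] == [set c; d]) = false by rewrite set2_neql.
have -> : ([set a; d] == [set c; d]) = false by rewrite set2_neql.
have -> : ([set b; c] == [set c; d]) = false by rewrite set2_neql.
have -> : ([set b; d] == [set c; d]) = false by rewrite set2_neql.
rewrite eqxx.
have -> : ([set c; d] == [set a; b]) = false by rewrite set2_neql // eq_sym.
have -> : ([set c; a] == [set a; b]) = false by rewrite set2_neql // eq_sym.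
have -> : ([set c; b] == [set a; b]) = false by rewrite set2_neql // eq_sym.
have -> : ([set d; a] == [set a; b]) = false by rewrite set2_neql // eq_sym.
have -> : ([set d; b] == [set a; b]) = false by rewrite set2_neql // eq_sym.
rewrite /= !mulr0n !mulr1n.
rewrite !(mulr0, subr0, add0r, mul0r, addr0, sub0r, mulr1, mulrN, mulNr, opprK).
have h (x y z : R) : x ^+ 2 * y / (x * z) = x * y / z.
  have [->|x0] := eqVneq x 0; first by rewrite !mul0r expr0n /= !mul0r.
  have [->|z0] := eqVneq z 0; first by rewrite mulr0 invr0 !mulr0.
  by field; rewrite x0 z0.
by rewrite !h; congr (_ / _); rewrite mulrC.
Qed.

Lemma ddih_adjacent a b c d : uniq [:: a; b; c; d] -> sdet p a b c d != 0 ->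
  ddih p (unit_dl R [set a; c]) a b c d = ddih p (unit_dl R [set a; b]) a c b d.
Proof.
move=> U D0; have [[ab ac ad] [bc bd] cd] := uniq4 U.
have U' : uniq [:: a; c; b; d].
  by rewrite /= !inE !negb_or ab ac ad bd cd eq_sym bc.
have L1 := len_gt0 U D0.
have D0' : sdet p a c b d != 0 by rewrite sdet23 oppr_eq0.
have L2 := len_gt0 U' D0'.
have P0 := gramsq_gt0 U D0.
have eP : gramsq p a c b = gramsq p a b c.
  by rewrite /gramsq (setUC [set a]) edotC mulrC.
rewrite /ddih /dcos /dgram /dgramsq /dedot -/l sdet23 normrN /unit_dl !eqxx.
have -> : ([set a; b] == [set a; c]) = false.
  by rewrite set2_neqr // eq_sym.
have -> : ([set a; d] == [set a; c]) = false by rewrite set2_neqr // eq_sym.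
have -> : ([set c; d] == [set a; c]) = false by rewrite set2_neqr // eq_sym.
have -> : ([set b; c] == [set a; c]) = false by rewrite set2_neql // eq_sym.
have -> : ([set b; d] == [set a; c]) = false by rewrite set2_neql // eq_sym.
have -> : ([set a; c] == [set a; b]) = false by rewrite set2_neqr // eq_sym.
have -> : ([set a; d] == [set a; b]) = false by rewrite set2_neqr // eq_sym.
have -> : ([set b; d] == [set a; b]) = false by rewrite set2_neqr // eq_sym.
have -> : ([set c; b] == [set a; b]) = false by rewrite set2_neql // eq_sym.
have -> : ([set c; d] == [set a; b]) = false by rewrite set2_neql // eq_sym.
rewrite /= !mulr0n !mulr1n.
rewrite !(mulr0, subr0, add0r, mul0r, addr0, sub0r, mulr1, mulrN, mulNr, opprK).
rewrite eP /gram -/l (edotC a b c).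
have ng : `|sdet p a c b d| != 0 by rewrite normr_eq0.
have l1 : l [set a; b] != 0 by rewrite gt_eqF.
have l2 : l [set a; c] != 0 by rewrite gt_eqF.
have : gramsq p a b c != 0 by rewrite gt_eqF.
rewrite /gramsq -/l -exprMn => g0.
by field; rewrite ng l2 g0 l1.
Qed.

(** [ddih] for the dihedral angle at the edge [j] of the tetrahedron [t]. *)
Definition ddih_at m j t : R :=
  match enum j, enum (t :\: j) with
  | [:: a; b], [:: c; d] => ddih p m a b c d
  | _, _ => 0
  end.

Lemma set4D a b c d : uniq [:: a; b; c; d] ->
  [set a; b; c; d] :\: [set a; b] = [set c; d].
Proof.
move=> U; have [[ab ac ad] [bc bd] cd] := uniq4 U.
apply/setP => x; rewrite !inE.
have [->|_] := eqVneq x a; first by rewrite /= (negbTE ac) (negbTE ad).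
by have [->|_] := eqVneq x b; first by rewrite /= (negbTE bc) (negbTE bd).
Qed.

Lemma ddih_atE m a b c d : uniq [:: a; b; c; d] ->
  ddih_at m [set a; b] [set a; b; c; d] = ddih p m a b c d.
Proof.
move=> U; have [[ab _ _] _ cd] := uniq4 U.
rewrite /ddih_at set4D //.
have [->|->] := enum2 ab; have [->|->] := enum2 cd => //.
- exact: ddih_swap34.
- exact: ddih_swap12.
- by rewrite ddih_swap12 ddih_swap34.
Qed.

Lemma is_derive_dihedral_at k a b c d :
  uniq [:: a; b; c; d] -> sdet p a b c d != 0 ->
  is_derive (l k) 1
    (fun s : R => dihedral_at (upd l k s) [set a; b] [set a; b; c; d])
    (ddih_at (unit_dl R k) [set a; b] [set a; b; c; d]).
Proof.
move=> U D0; have [[ab ac ad] [bc bd] cd] := uniq4 U.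
rewrite /ddih_at /dihedral_at set4D //.
have [->|->] := enum2 ab; have [->|->] := enum2 cd; apply: is_derive_dihedral => //;
  rewrite /= ?inE ?negb_or ?(eq_sym b a) ?(eq_sym d c) ?ab ?ac ?ad ?bc ?bd ?cd //.
- by rewrite sdet34 oppr_eq0.
- by rewrite sdet12 oppr_eq0.
- by rewrite sdet12 sdet34 opprK.
Qed.

Lemma volE a b c d : uniq [:: a; b; c; d] ->
  vol p [set a; b; c; d] = `|sdet p a b c d| / 6.
Proof.
move=> U; rewrite /vol; set t := [set a; b; c; d].
have t4 : #|t| = 4%N by apply/eqP; rewrite card_set4.
have : size (enum t) = 4%N by rewrite -cardE.
have := enum_uniq t; have := set_enum t.
case: (enum t) => [|x [|y [|z [|w [|? ?]]]]] //= e1 e2 _.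
pose P x y z w := `|sdet p x y z w| / 6 = `|sdet p a b c d| / 6.
have /(_ x y z w) : forall x y z w, uniq [:: x; y; z; w] ->
    [set x; y; z; w] = t -> P x y z w.
  apply: (@labelling4_ind V t P a b c d) => // x' y' z' w' _ h.
  by split; rewrite /P; [rewrite sdet12|rewrite sdet23|rewrite sdet34]; rewrite normrN.
apply; first exact: e2.
by rewrite -e1; apply/setP => v; rewrite !inE -!orbA.
Qed.

Lemma vol_gt0 a b c d : uniq [:: a; b; c; d] ->
  (0 < vol p [set a; b; c; d]) = (sdet p a b c d != 0).
Proof. by move=> U; rewrite volE // pmulr_lgt0 // normr_gt0. Qed.

(** The sign of the labelling abcd for an orientation of the complex. *)
Definition osign (o : orientation V) a b c d : R := if o a b c d then 1 else -1.

(** The value does not depend on the enumeration of the tetrahedron: an odd permutation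
    changes both signs. *)
Lemma tet_signE K o a b c d : consistent_orientation K o ->
  uniq [:: a; b; c; d] -> [set a; b; c; d] \in tets K ->
  sdet p a b c d != 0 ->
  tet_sign o p [set a; b; c; d] =
  - (osign o a b c d * Num.sg (sdet p a b c d)).
Proof.
move=> [ho _] U tK D0; rewrite /tet_sign; set t := [set a; b; c; d].
have t4 : #|t| = 4%N by apply/eqP; rewrite card_set4.
have : size (enum t) = 4%N by rewrite -cardE.
have := enum_uniq t; have := set_enum t.
case: (enum t) => [|x [|y [|z [|w [|? ?]]]]] //= e1 e2 _.
pose P x y z w := sdet p x y z w != 0 /\
  (osign o x y z w * Num.sg (sdet p x y z w)) =
  (osign o a b c d * Num.sg (sdet p a b c d)).
have /(_ x y z w) [] // : forall x y z w, uniq [:: x; y; z; w] ->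
    [set x; y; z; w] = t -> P x y z w.
- apply: (@labelling4_ind V t P a b c d) => // x' y' z' w' et [h1 h2].
  have [|o1 o2 o3] := ho x' y' z' w'; first by rewrite et.
  have ng (b1 : bool) : (if ~~ b1 then 1 else -1) = - (if b1 then 1 else -1) :> R.
    by case: b1; rewrite ?opprK.
  split; rewrite /P; [rewrite sdet12|rewrite sdet23|rewrite sdet34];
    rewrite oppr_eq0; split=> //; rewrite sgrN -h2 /osign.
  - by rewrite o1 ng mulrNN.
  - by rewrite o2 ng mulrNN.
  - by rewrite o3 ng mulrNN.
- by rewrite -e1; apply/setP => v; rewrite !inE -!orbA.
move=> h1 <-; rewrite /osign.
case: (ltrgtP 0 (sdet p x y z w)) h1 => [h _|h _|e]; last by [].
  by rewrite gtr0_sg //; case: (o _ _ _ _); rewrite /= mulr1 ?opprK.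
by rewrite ltr0_sg //; case: (o _ _ _ _); rewrite /= mulrN1 ?opprK.
Qed.

End Tetrahedron.

(** * Symmetry of the matrix of derivatives of the defect angles *)

Section DefectMatrix.
Variables (R : realType) (V : finType).
Implicit Types (K : scomplex V) (o : orientation V) (p : V -> 'rV[R]_3).
Implicit Types (a b c d : V) (j k t : {set V}).

Lemma edges_card K j : j \in edges K -> #|j| = 2%N.
Proof. by rewrite inE => /andP[_ /eqP]. Qed.

Lemma tets_card K t : t \in tets K -> #|t| = 4%N.
Proof. by rewrite inE => /andP[_ /eqP]. Qed.

Lemma permitted_sdet K p a b c d : permitted K p -> uniq [:: a; b; c; d] ->
  [set a; b; c; d] \in tets K -> sdet p a b c d != 0.
Proof. by move=> hp U /hp; rewrite vol_gt0. Qed.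

(** The rows of the matrix are sums over the tetrahedra at an edge [j]; the edge need not
    belong to the complex. *)
Lemma domegaE K o p j k : permitted K p -> #|j| = 2%N ->
  domega K o p j k =
  \sum_(t in tets K | j \subset t)
     tet_sign o p t * ddih_at p (unit_dl R k) j t.
Proof.
move=> hp j2; rewrite /domega derive1E; apply: derive_val.
apply: is_derive_sumf => t /andP[tK jt].
have [a [b [c [d [U ej et]]]]] := edge_tet_labelling j2 (tets_card tK) jt.
subst j t; have D0 := permitted_sdet hp U tK.
have h := is_deriveMf (is_derive_cst (tet_sign o p [set a; b; c; d]) (len p k) 1)
  (is_derive_dihedral_at k U D0).
by apply: (is_derive_eq h); rewrite mul0r add0r.
Qed.

Lemma ddih_at_out p j k t : #|j| = 2%N -> #|k| = 2%N -> #|t| = 4%N -> j \subset t ->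
  ~~ (k \subset t) -> ddih_at p (unit_dl R k) j t = 0.
Proof.
move=> j2 k2 t4 jt kt.
have [a [b [c [d [U ej et]]]]] := edge_tet_labelling j2 t4 jt.
subst j t; rewrite ddih_atE //.
have e x y : x \in [set a; b; c; d] -> y \in [set a; b; c; d] ->
    ([set x; y] == k) = false.
  by move=> hx hy; apply/eqP => hk; move: kt; rewrite -hk subUset !sub1set hx hy.
rewrite /ddih /dcos /dgram /dgramsq /dedot /unit_dl !e ?inE ?eqxx ?orbT //.
by rewrite !(mulr0n, mulr0, subr0, addr0, mul0r, oppr0).
Qed.

Lemma ddih_atC p j k t : #|j| = 2%N -> #|k| = 2%N -> #|t| = 4%N ->
  j \subset t -> k \subset t -> 0 < vol p t ->
  ddih_at p (unit_dl R k) j t = ddih_at p (unit_dl R j) k t.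
Proof.
move=> j2 k2 t4 jt kt vt.
have [a [b [c [d [U ej et]]]]] := edge_tet_labelling j2 t4 jt.
subst j t; move: vt; rewrite vol_gt0 // => D0.
have [[ab ac ad] [bc bd] cd] := uniq4 U.
have /cards2P[x [y [xy ek]]] : #|k| == 2%N by rewrite k2.
(* two edges sharing the vertex a, in any labelling *)
have adj a' b' c' d' : [set a'; b'; c'; d'] = [set a; b; c; d] ->
    sdet p a' b' c' d' != 0 ->
    ddih_at p (unit_dl R [set a'; c']) [set a'; b'] [set a; b; c; d] =
    ddih_at p (unit_dl R [set a'; b']) [set a'; c'] [set a; b; c; d].
  move=> e D'; have U' : uniq [:: a'; b'; c'; d'] by rewrite -card_set4 e t4.
  rewrite -e ddih_atE // -set4_swap23 ddih_atE; first exact: ddih_adjacent.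
  by rewrite -card_set4 set4_swap23 e t4.
have opp : ddih_at p (unit_dl R [set c; d]) [set a; b] [set a; b; c; d] =
    ddih_at p (unit_dl R [set a; b]) [set c; d] [set a; b; c; d].
  have e : [set a; b; c; d] = [set c; d; a; b] by rewrite -setUA setUC setUA.
  rewrite ddih_atE // e ddih_atE; first exact: ddih_opposite.
  by rewrite -card_set4 -e t4.
have swap (P : V -> V -> Prop) : (forall u v, P u v -> P v u) ->
    P a b -> P a c -> P a d -> P b c -> P b d -> P c d ->
    forall u v, u != v -> u \in [set a; b; c; d] -> v \in [set a; b; c; d] -> P u v.
  move=> sP Pab Pac Pad Pbc Pbd Pcd u v uv; rewrite !inE -!orbA.
  by move=> /or4P[] /eqP eu /or4P[] /eqP ev; subst u v;
    move: uv; rewrite ?eqxx //; auto.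
have xt : x \in [set a; b; c; d] 
  by rewrite -sub1set; apply: fintype.subset_trans kt; rewrite sub1set ek set21.
have yt : y \in [set a; b; c; d] 
  by rewrite -sub1set; apply: fintype.subset_trans kt; rewrite sub1set ek set22.
rewrite ek; move: x y xy xt yt {ek}.
apply: swap => //.
- by move=> u v; rewrite (setUC [set u]).
- exact: adj.
- by apply: (adj a b d c); [exact: set4_swap34 | rewrite sdet34 oppr_eq0].
- have := adj b a c d (set4_swap12 _ _ _ _).
  by rewrite sdet12 oppr_eq0 (setUC [set b] [set a]); apply.
- have := adj b a d c; rewrite set4_swap12 set4_swap34 sdet12 sdet34 opprK.
  by rewrite (setUC [set b] [set a]); apply.
Qed.

Lemma domega_sym K o p j k : permitted K p -> j \in edges K -> k \in edges K ->
  domega K o p j k = domega K o p k j.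
Proof.
move=> hp jE kE; rewrite !domegaE ?(edges_card jE) ?(edges_card kE) //.
have e (i i' : {set V}) : i \in edges K -> i' \in edges K ->
  \sum_(t in tets K | i \subset t) tet_sign o p t * ddih_at p (unit_dl R i') i t =
  \sum_(t in tets K | (i \subset t) && (i' \subset t))
     tet_sign o p t * ddih_at p (unit_dl R i') i t.
  move=> iE i'E; rewrite [LHS](bigID (fun t => i' \subset t)) /= addrC big1 ?add0r.
    by apply: eq_bigl => t; rewrite -andbA.
  move=> t /andP[/andP[tK it] i't].
  by rewrite ddih_at_out ?mulr0 ?(edges_card iE) ?(edges_card i'E) ?(tets_card tK).
rewrite (e j k) // (e k j) //; apply: eq_big => [t|t /andP[tK /andP[jt kt]]].
  by rewrite [(j \subset t) && _]andbC.
by rewrite ddih_atC ?(edges_card jE) ?(edges_card kE) ?(tets_card tK) // hp.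
Qed.

End DefectMatrix.

(** * The boundary of the 4-simplex gives a matrix of rank one *)

Section FivePoints.
Variables (R : realType) (V : finType) (p : V -> 'rV[R]_3).
Implicit Types (a b c d e : V) (j t : {set V}) (m : {set V} -> R).

Lemma sdet_uniq a b c d : sdet p a b c d != 0 -> uniq [:: a; b; c; d].
Proof.
move=> D0; rewrite /= !inE !negb_or andbT.
by apply/and3P; split; [apply/and3P; split | apply/andP; split | ];
  apply: contraNneq D0 => e; rewrite /sdet det3E !mxE e; apply/eqP; ring.
Qed.

(** The differential, in the direction [m], of the dihedral angle of abcd
    at the edge [j], with the sign of the orientation of abcd in space; zero if [j] is
    not an edge of abcd. *)
Definition tet_row j m a b c d : R :=
  if j \subset [set a; b; c; d]
  then Num.sg (sdet p a b c d) * ddih_at p m j [set a; b; c; d] else 0.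

Lemma tet_row12 j m a b c d : tet_row j m b a c d = - tet_row j m a b c d.
Proof.
rewrite /tet_row set4_swap12; case: ifP => _; last by rewrite oppr0.
by rewrite sdet12 sgrN mulNr.
Qed.

Lemma tet_row23 j m a b c d : tet_row j m a c b d = - tet_row j m a b c d.
Proof.
rewrite /tet_row set4_swap23; case: ifP => _; last by rewrite oppr0.
by rewrite sdet23 sgrN mulNr.
Qed.

Lemma tet_row34 j m a b c d : tet_row j m a b d c = - tet_row j m a b c d.
Proof.
rewrite /tet_row set4_swap34; case: ifP => _; last by rewrite oppr0.
by rewrite sdet34 sgrN mulNr.
Qed.

(** The sum over the boundary of the 4-simplex abcde. *)
Definition bd_row j m a b c d e : R :=
  tet_row j m b c d e - tet_row j m a c d e + tet_row j m a b d e
  - tet_row j m a b c e + tet_row j m a b c d.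

(** The product of the five coefficients of the affine dependency; the signs of the
    second and the fourth cancel. *)
Definition stress_prod a b c d e : R :=
  sdet p b c d e * sdet p a c d e * sdet p a b d e * sdet p a b c e * sdet p a b c d.

(** The rank-one formula for the row [j].  Both sides are alternating in the five points, so it
    is preserved by adjacent transpositions. *)
Definition bd_rowP j m a b c d e : Prop :=
  stress_prod a b c d e != 0 ->
  bd_row j m a b c d e =
  stress p (unit_dl R j) a b c d e * stress p m a b c d e
  / stress_prod a b c d e.

Lemma stress_prod_neq0 a b c d e : stress_prod a b c d e != 0 ->
  [/\ sdet p b c d e != 0, sdet p a c d e != 0, sdet p a b d e != 0,
      sdet p a b c e != 0 & sdet p a b c d != 0].
Proof. by rewrite /stress_prod !mulf_eq0 !negb_or -!andbA => /and5P. Qed.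

Lemma bd_rowP12 j m a b c d e : bd_rowP j m b a c d e -> bd_rowP j m a b c d e.
Proof.
have -> : bd_rowP j m b a c d e = bd_rowP j m a b c d e; last by [].
have e1 : stress_prod b a c d e = - stress_prod a b c d e.
  by rewrite /stress_prod (sdet12 p a b d) (sdet12 p a b c) (sdet12 p a b); ring.
have e2 m' : stress p m' b a c d e = stress p m' a b c d e.
  by rewrite /stress (sdet12 p a b d) (sdet12 p a b c) (sdet12 p a b)
     (setUC [set b]) /=; ring.
rewrite /bd_rowP e1 !e2 oppr_eq0 invrN mulrN.
have -> : bd_row j m b a c d e = - bd_row j m a b c d e.
  by rewrite /bd_row !(tet_row12 _ _ a b); ring.
rewrite propeqE; split=> h /h; first exact: oppr_inj.
by move->.
Qed.

Lemma bd_rowP23 j m a b c d e : bd_rowP j m a c b d e -> bd_rowP j m a b c d e.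
Proof.
have -> : bd_rowP j m a c b d e = bd_rowP j m a b c d e; last by [].
have e1 : stress_prod a c b d e = - stress_prod a b c d e.
  by rewrite /stress_prod (sdet12 p b c) !(sdet23 p a b c); ring.
have e2 m' : stress p m' a c b d e = stress p m' a b c d e.
  by rewrite /stress (sdet12 p b c) !(sdet23 p a b c) (setUC [set c] [set b]) /=; ring.
rewrite /bd_rowP e1 !e2 oppr_eq0 invrN mulrN.
have -> : bd_row j m a c b d e = - bd_row j m a b c d e.
  by rewrite /bd_row (tet_row12 _ _ b c) !(tet_row23 _ _ a b c); ring.
rewrite propeqE; split=> h /h; first exact: oppr_inj.
by move->.
Qed.

Lemma bd_rowP34 j m a b c d e : bd_rowP j m a b d c e -> bd_rowP j m a b c d e.
Proof.
have -> : bd_rowP j m a b d c e = bd_rowP j m a b c d e; last by [].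
have e1 : stress_prod a b d c e = - stress_prod a b c d e.
  by rewrite /stress_prod (sdet23 p b c d) (sdet23 p a c d) (sdet34 p a b c d); ring.
have e2 m' : stress p m' a b d c e = stress p m' a b c d e.
  by rewrite /stress (sdet23 p b c d) (sdet23 p a c d) (sdet34 p a b c d)
     (setUC [set d] [set c]) /=; ring.
rewrite /bd_rowP e1 !e2 oppr_eq0 invrN mulrN.
have -> : bd_row j m a b d c e = - bd_row j m a b c d e.
  rewrite /bd_row (tet_row23 _ _ b c d) (tet_row23 _ _ a c d).
  by rewrite (tet_row34 _ _ a b c d); ring.
rewrite propeqE; split=> h /h; first exact: oppr_inj.
by move->.
Qed.

Lemma bd_rowP45 j m a b c d e : bd_rowP j m a b c e d -> bd_rowP j m a b c d e.
Proof.
have -> : bd_rowP j m a b c e d = bd_rowP j m a b c d e; last by [].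
have e1 : stress_prod a b c e d = - stress_prod a b c d e.
  by rewrite /stress_prod !(sdet34 p _ _ d e); ring.
have e2 m' : stress p m' a b c e d = stress p m' a b c d e.
  by rewrite /stress !(sdet34 p _ _ d e) (setUC [set e] [set d]) /=; ring.
rewrite /bd_rowP e1 !e2 oppr_eq0 invrN mulrN.
have -> : bd_row j m a b c e d = - bd_row j m a b c d e.
  by rewrite /bd_row !(tet_row34 _ _ _ _ d e); ring.
rewrite propeqE; split=> h /h; first exact: oppr_inj.
by move->.
Qed.

(** Only three of the five tetrahedra contain the edge ab. *)
Lemma bd_rowP_base m a b c d e : bd_rowP [set a; b] m a b c d e.
Proof.
move=> S0; have [D1 D2 D3 D4 D5] := stress_prod_neq0 S0.
have [[ab ac ad] [bc bd] cd] := uniq4 (sdet_uniq D5).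
have [[_ _ ae] [_ be] ce] := uniq4 (sdet_uniq D4).
have [[_ _ _] [_ _] de] := uniq4 (sdet_uniq D3).
have st : stress p (unit_dl R [set a; b]) a b c d e =
    sdet p b c d e * - sdet p a c d e * len p [set a; b].
  rewrite /stress /unit_dl /= eqxx.
  have -> : ([set a; c] == [set a; b]) = false by rewrite set2_neqr // eq_sym.
  have -> : ([set a; d] == [set a; b]) = false by rewrite set2_neqr // eq_sym.
  have -> : ([set a; e] == [set a; b]) = false by rewrite set2_neqr // eq_sym.
  have -> : ([set b; c] == [set a; b]) = false by rewrite set2_neqr // eq_sym.
  have -> : ([set b; d] == [set a; b]) = false by rewrite set2_neqr // eq_sym.
  have -> : ([set b; e] == [set a; b]) = false by rewrite set2_neqr // eq_sym.
  have -> : ([set c; d] == [set a; b]) = false by rewrite set2_neql // eq_sym.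
  have -> : ([set c; e] == [set a; b]) = false by rewrite set2_neql // eq_sym.
  have -> : ([set d; e] == [set a; b]) = false by rewrite set2_neql // eq_sym.
  by rewrite /= !mulr0n !mulr1n; ring.
have sub x y : [set a; b] \subset [set a; b; x; y].
  by rewrite subUset !sub1set !inE !eqxx ?orbT.
have row x y : sdet p a b x y != 0 ->
    tet_row [set a; b] m a b x y = sddih p m a b x y.
  by move=> D0; rewrite /tet_row sub ddih_atE ?sdet_uniq // sddihE.
have nsub x y z : a != x -> a != y -> a != z -> b != x -> b != y -> b != z ->
    forall w, (w == a) || (w == b) -> [set a; b] \subset [set w; x; y; z] = false.
  move=> ax ay az bx by' bz w /orP[] /eqP->; rewrite subUset !sub1set !inE eqxx ?orbT /=.
    by rewrite (eq_sym b a) (negbTE ab) (negbTE bx) (negbTE by') (negbTE bz).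
  by rewrite (negbTE ab) (negbTE ax) (negbTE ay) (negbTE az).
have r1 : tet_row [set a; b] m b c d e = 0.
  by rewrite /tet_row nsub ?eqxx ?orbT.
have r2 : tet_row [set a; b] m a c d e = 0.
  by rewrite /tet_row nsub ?eqxx.
have U5 : uniq [:: a; b; c; d; e].
  by rewrite /= !inE !negb_or ab ac ad ae bc bd be cd ce de.
have D4' : sdet p a b e c != 0 by rewrite sdet34 oppr_eq0.
have := @sum_sddih R V p m a b c d e U5 (And3 D3 D4' D5).
rewrite /bd_row r1 r2 !row // -!row // (tet_row34 _ _ a b c e) => h.
transitivity (tet_row [set a; b] m a b c d + tet_row [set a; b] m a b d e +
     - tet_row [set a; b] m a b c e); first by ring.
rewrite h st /stress_prod (sdet34 p a b c e); field.
by rewrite D1 D2 D3 D4 D5.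
Qed.

Lemma bd_row_edge j m a b c d e : #|j| = 2%N -> j \subset [set a; b; c; d; e] ->
  bd_rowP j m a b c d e.
Proof.
move=> /eqP/cards2P[x [y [xy ->]]]; rewrite subUset !sub1set => /andP[].
pose P x y := bd_rowP [set x; y] m a b c d e.
rewrite -/(P x y).
have Pab : P a b by apply: bd_rowP_base.
have Pac : P a c by apply/bd_rowP23/bd_rowP_base.
have Pad : P a d by apply/bd_rowP34/bd_rowP23/bd_rowP_base.
have Pae : P a e by apply/bd_rowP45/bd_rowP34/bd_rowP23/bd_rowP_base.
have Pbc : P b c by apply/bd_rowP12/bd_rowP23/bd_rowP_base.
have Pbd : P b d by apply/bd_rowP12/bd_rowP34/bd_rowP23/bd_rowP_base.
have Pbe : P b e by apply/bd_rowP12/bd_rowP45/bd_rowP34/bd_rowP23/bd_rowP_base.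
have Pcd : P c d.
  by apply/bd_rowP23/bd_rowP12/bd_rowP34/bd_rowP23/bd_rowP_base.
have Pce : P c e.
  by apply/bd_rowP23/bd_rowP12/bd_rowP45/bd_rowP34/bd_rowP23/bd_rowP_base.
have Pde : P d e.
  by apply/bd_rowP34/bd_rowP23/bd_rowP12/bd_rowP45/bd_rowP34/bd_rowP23/bd_rowP_base.
have sP u v : P u v -> P v u by rewrite /P (setUC [set u]).
move: xy; rewrite !inE -!orbA => xy.
by move=> /or4P[|||/orP[]] /eqP ex /or4P[|||/orP[]] /eqP ey; subst x y;
  move: xy; rewrite ?eqxx //; auto.
Qed.

Lemma stress_out j a b c d e : ~~ (j \subset [set a; b; c; d; e]) ->
  stress p (unit_dl R j) a b c d e = 0.
Proof.
move=> nj.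
have e0 x y : x \in [set a; b; c; d; e] -> y \in [set a; b; c; d; e] ->
    ([set x; y] == j) = false.
  by move=> hx hy; apply/eqP => hk; move: nj; rewrite -hk subUset !sub1set hx hy.
rewrite /stress /unit_dl /= !e0 ?inE ?eqxx ?orbT //=.
by rewrite !(mulr0n, mulr0, addr0).
Qed.

End FivePoints.

(** * The simplices exchanged by a move *)

Section Move.
Variables (R : realType) (V : finType).
Implicit Types (K : scomplex V) (o : orientation V) (p : V -> 'rV[R]_3).
Implicit Types (a b c d e x : V) (j k t : {set V}).

Lemma uniq5 a b c d e : uniq [:: a; b; c; d; e] ->
  [/\ [/\ a != b, a != c, a != d & a != e], [/\ b != c, b != d & b != e],
      c != d /\ c != e & d != e].
Proof.
rewrite /= !inE !negb_or andbT.
by move=> /and4P[/and4P[-> -> -> ->] /and3P[-> -> ->] /andP[-> ->] ->].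
Qed.

Lemma move23_edges K K' a b c d e : move23 K K' a b c d e ->
  edges K' = [set d; e] |: edges K /\ [set d; e] \notin edges K.
Proof.
case=> U abcd abce nde eK'.
have [[ab ac ad ae] [bc bd be] [cd ce] de] := uniq5 U.
have c3 x y z : uniq [:: x; y; z] -> #|[set x; y; z]| = 3%N.
  move=> U3; have -> : #|[set x; y; z]| = #|[:: x; y; z]|.
    by apply: eq_card => v; rewrite !inE -!orbA.
  exact/card_uniqP.
have c4 x y z w : uniq [:: x; y; z; w] -> #|[set x; y; z; w]| = 4%N.
  by move=> U4; apply/eqP; rewrite card_set4.
split; last by rewrite inE negb_and nde.
have card_neq (s s' : {set V}) n : #|s'| = n -> #|s| != n -> (s == s') = false.
  by move=> h; apply: contraNF => /eqP ->; rewrite h.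
apply/setP => s; rewrite [LHS]inE [RHS]inE [s \in edges K]inE in_set1 eK'.
have [s2|] := eqVneq #|s| 2%N; last first.
  rewrite !andbF orbF; move=> s2; apply/esym/negbTE; apply: contra s2 => /eqP ->.
  by rewrite cards2 de.
rewrite !andbT !inE.
rewrite !(@card_neq s [set a; b; c] 3) ?s2 ?c3 //; last first.
  by rewrite /= !inE !negb_or ab ac bc.
rewrite !(@card_neq s [set a; d; e] 3) ?s2 ?c3 //; last first.
  by rewrite /= !inE !negb_or ad ae de.
rewrite !(@card_neq s [set b; d; e] 3) ?s2 ?c3 //; last first.
  by rewrite /= !inE !negb_or bd be de.
rewrite !(@card_neq s [set c; d; e] 3) ?s2 ?c3 //; last first.
  by rewrite /= !inE !negb_or cd ce de.
rewrite !(@card_neq s [set a; b; c; d] 4) ?s2 ?c4 //; last first.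
  by rewrite /= !inE !negb_or ab ac ad bc bd cd.
rewrite !(@card_neq s [set a; b; c; e] 4) ?s2 ?c4 //; last first.
  by rewrite /= !inE !negb_or ab ac ae bc be ce.
rewrite !(@card_neq s [set a; b; d; e] 4) ?s2 ?c4 //; last first.
  by rewrite /= !inE !negb_or ab ad ae bd be de.
rewrite !(@card_neq s [set b; c; d; e] 4) ?s2 ?c4 //; last first.
  by rewrite /= !inE !negb_or bc bd be cd ce de.
rewrite !(@card_neq s [set c; a; d; e] 4) ?s2 ?c4 //; last first.
  by rewrite /= !inE !negb_or (eq_sym c a) ac cd ce ad ae de.
by rewrite !orbF /= orbC.
Qed.

Lemma move23_tets K K' a b c d e t : move23 K K' a b c d e ->
  (t \in tets K') =
  [|| [&& t != [set a; b; c; d], t != [set a; b; c; e] & t \in tets K],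
      t == [set a; b; d; e], t == [set b; c; d; e] | t == [set c; a; d; e]].
Proof.
case=> U abcd abce nde eK'.
have [[ab ac ad ae] [bc bd be] [cd ce] de] := uniq5 U.
have c3 x y z : (#|[set x; y; z]| <= 3)%N.
  have -> : #|[set x; y; z]| = #|[:: x; y; z]|.
    by apply: eq_card => v; rewrite !inE -!orbA.
  exact: card_size.
have c2 x y : (#|[set x; y]| <= 2)%N by rewrite cards2; case: (_ != _).
have c4 x y z w : uniq [:: x; y; z; w] -> #|[set x; y; z; w]| == 4%N.
  by rewrite card_set4.
rewrite [LHS]inE [t \in tets K]inE eK'.
have [t4|t4] := eqVneq #|t| 4%N; last first.
  rewrite !andbF /=; apply/esym/negbTE.
  apply: contra t4 => /or3P[] /eqP ->; apply: c4; rewrite /= !inE !negb_or.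
  - by rewrite ab ad ae bd be de.
  - by rewrite bc bd be cd ce de.
  - by rewrite (eq_sym c a) ac cd ce ad ae de.
rewrite !andbT !inE.
have n3 x y z : (t == [set x; y; z]) = false.
  by apply/eqP => h; have := c3 x y z; rewrite -h t4.
have n2 x y : (t == [set x; y]) = false.
  by apply/eqP => h; have := c2 x y; rewrite -h t4.
by rewrite !n3 !n2 /= negb_or -!andbA -!orbA.
Qed.

(** The move exchanges two tetrahedra for three and keeps the others. *)
Lemma move23_big (W : Type) (idx : W) (op : Monoid.com_law idx)
    K K' a b c d e (f f' : {set V} -> W) : move23 K K' a b c d e ->
  (forall t, t \in tets K -> t \in tets K' -> f' t = f t) ->
  exists w,
    \big[op/idx]_(t in tets K) f t =
      op (f [set a; b; c; d]) (op (f [set a; b; c; e]) w) /\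
    \big[op/idx]_(t in tets K') f' t =
      op (f' [set a; b; d; e]) (op (f' [set b; c; d; e])
        (op (f' [set c; a; d; e]) w)).
Proof.
move=> M ff; have tE := move23_tets _ M; case: M => U abcd abce nde eK'.
have [[ab ac ad ae] [bc bd be] [cd ce] de] := uniq5 U.
have tneq (x : V) (s s' : {set V}) : x \in s -> x \notin s' -> s != s'.
  by move=> h; apply: contraNneq => <-.
have n12 : [set a; b; c; e] != [set a; b; c; d].
  apply: (tneq e); rewrite !inE ?eqxx ?orbT // !negb_or.
  by rewrite (eq_sym e a) (eq_sym e b) (eq_sym e c) (eq_sym e d) ae be ce de.
have n34 : [set b; c; d; e] != [set a; b; d; e].
  by apply: (tneq c); rewrite !inE ?eqxx ?orbT // !negb_or (eq_sym c a) (eq_sym c b) ac bc cd ce.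
have n35 : [set c; a; d; e] != [set a; b; d; e].
  by apply: (tneq c); rewrite !inE ?eqxx ?orbT // !negb_or (eq_sym c a) (eq_sym c b) ac bc cd ce.
have n45 : [set c; a; d; e] != [set b; c; d; e].
  by apply: (tneq a); rewrite !inE ?eqxx ?orbT // !negb_or ab ac ad ae.
have t1K : [set a; b; c; d] \in tets K.
  by rewrite inE abcd /= card_set4 /= !inE !negb_or ab ac ad bc bd cd.
have t2K : [set a; b; c; e] \in tets K.
  by rewrite inE abce /= card_set4 /= !inE !negb_or ab ac ae bc be ce.
have newK x y : [set x; y; d; e] \notin tets K.
  apply: contra nde; rewrite inE => /andP[h _].
  apply: (faces_down h); last by apply/set0Pn; exists d; rewrite set21.
  by rewrite subUset !sub1set !inE !eqxx ?orbT.
pose X := tets K :\ [set a; b; c; d] :\ [set a; b; c; e].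
have XE : X = tets K' :\ [set a; b; d; e] :\ [set b; c; d; e] :\ [set c; a; d; e].
  apply/setP => t; rewrite /X !in_setD1 tE.
  have [->|_] := eqVneq t [set c; a; d; e]; first by rewrite /= (negbTE (newK _ _)) !andbF.
  have [->|_] := eqVneq t [set b; c; d; e]; first by rewrite /= (negbTE (newK _ _)) !andbF.
  have [->|_] := eqVneq t [set a; b; d; e]; first by rewrite /= (negbTE (newK _ _)) !andbF.
  by rewrite /= !orbF; do 2 case: (t != _).
exists (\big[op/idx]_(t in X) f t); split.
  by rewrite (big_setD1 _ t1K) (big_setD1 [set a; b; c; e]) //= in_setD1 n12.
have -> : \big[op/idx]_(t in X) f t = \big[op/idx]_(t in X) f' t.
  apply: eq_bigr => t tX; apply/esym/ff.
    by move: tX; rewrite !in_setD1 => /and3P[].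
  by move: tX; rewrite XE !in_setD1 => /and4P[].
rewrite XE (big_setD1 [set a; b; d; e]) /=; last by rewrite tE eqxx !orbT.
congr (op _ _); rewrite (big_setD1 [set b; c; d; e]) /=; last first.
  by rewrite in_setD1 n34 tE eqxx !orbT.
congr (op _ _); rewrite (big_setD1 [set c; a; d; e]) //=.
by rewrite !in_setD1 n45 n35 tE eqxx !orbT.
Qed.

Lemma move23_sum K K' a b c d e (f f' : {set V} -> R) : move23 K K' a b c d e ->
  (forall t, t \in tets K -> t \in tets K' -> f' t = f t) ->
  \sum_(t in tets K') f' t = \sum_(t in tets K) f t
    - f [set a; b; c; d] - f [set a; b; c; e]
    + f' [set a; b; d; e] + f' [set b; c; d; e] + f' [set c; a; d; e].
Proof. by move=> M ff; have [x] := move23_big +%R M ff; rewrite /= => -[-> ->]; ring. Qed.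

End Move.

(** * Orientations and the change of the matrix under a move *)

Section MoveMatrix.
Variables (R : realType) (V : finType).
Implicit Types (K : scomplex V) (o : orientation V) (p : V -> 'rV[R]_3).
Implicit Types (a b c d e x : V) (j k t : {set V}).

Lemma osign_swap K o a b c d : consistent_orientation K o ->
  [set a; b; c; d] \in tets K ->
  [/\ osign R o b a c d = - osign R o a b c d,
      osign R o a c b d = - osign R o a b c d &
      osign R o a b d c = - osign R o a b c d].
Proof.
case=> ho _ /ho [e1 e2 e3].
have ng (b1 : bool) : (if ~~ b1 then 1 else -1) = - (if b1 then 1 else -1) :> R.
  by case: b1; rewrite ?opprK.
by rewrite /osign e1 e2 e3 !ng.
Qed.

Lemma osign_face K o a b c d e : consistent_orientation K o ->
  [set a; b; c; d] \in tets K -> [set a; b; c; e] \in tets K -> d != e ->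
  osign R o a b c e = - osign R o a b c d.
Proof.
case=> _ ho h1 h2 de; rewrite /osign (ho _ _ _ _ _ h1 h2 de).
by case: (o a b c d); rewrite ?opprK.
Qed.

Lemma move23_tetsK K K' a b c d e : move23 K K' a b c d e ->
  [set a; b; c; d] \in tets K /\ [set a; b; c; e] \in tets K.
Proof.
case=> U abcd abce _ _; have [[ab ac ad ae] [bc bd be] [cd ce] de] := uniq5 U.
by rewrite !inE abcd abce !card_set4 /= !inE !negb_or ab ac ad ae bc bd be cd ce.
Qed.

(** The face abd lies in a tetrahedron abdx that the move keeps. *)
Lemma move23_outer_tet K K' a b c d e : move23 K K' a b c d e ->
  closed_3manifold R K \/ closed_3manifold R K' ->
  exists x, [/\ x != c, x != e, [set a; b; d; x] \in tets K
              & [set a; b; d; x] \in tets K'].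
Proof.
move=> M cl; have tE t := move23_tets t M.
have [t1K t2K] := move23_tetsK M.
case: (M) => U abcd abce nde eK'.
have [[ab ac ad ae] [bc bd be] [cd ce] de] := uniq5 U.
have abd3 : #|[set a; b; d]| = 3%N.
  have -> : #|[set a; b; d]| = #|[:: a; b; d]|.
    by apply: eq_card => v; rewrite !inE -!orbA.
  by apply/card_uniqP; rewrite /= !inE !negb_or ab ad bd.
(* a second tetrahedron at the face abd *)
have other (L : scomplex V) y : closed_3manifold R L -> [set a; b; d; y] \in tets L ->
    exists x, [/\ x != y, x \notin [set a; b; d] & [set a; b; d; x] \in tets L].
  case=> _ h2 _ hy.
  have s : [set a; b; d] \subset [set a; b; d; y] by apply: subsetUl.
  have : [set a; b; d] \in triangles L.
    rewrite inE abd3 eqxx andbT; move: hy; rewrite inE => /andP[h _].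
    by apply: (faces_down h s); apply/set0Pn; exists a; rewrite !inE eqxx.
  move=> /h2 /eqP /cards2P[t [t' [tt' eT]]].
  have memT u : (u \in tets L) && ([set a; b; d] \subset u) = (u \in [set t; t']).
    by rewrite -eT [RHS]inE.
  have [u [uy uT]] : exists u, u != [set a; b; d; y] /\ u \in [set t; t'].
    have [ty|ty] := eqVneq t [set a; b; d; y].
      by exists t'; rewrite -ty eq_sym tt' set22.
    by exists t; rewrite ty set21.
  move: uT; rewrite -memT => /andP[uL su].
  have /cards1P[x ex] : #|u :\: [set a; b; d]| == 1%N.
    by rewrite cardsD (setIidPr su) (tets_card uL) abd3.
  have eu : u = [set a; b; d; x].
    by rewrite -[LHS](setID u [set a; b; d]) (setIidPr su) ex.
  exists x; split; last by rewrite -eu.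
  - by apply: contraNneq uy => <-; rewrite -eu.
  - by have := set11 x; rewrite -ex inE => /andP[].
have eqT (x y : V) (s : {set V}) : y \in s -> y \notin [set a; b; d] ->
    [set a; b; d; x] == s -> x = y.
  move=> ys yn /eqP es; move: ys; rewrite -es in_setU (negbTE yn) in_set1.
  by move=> /eqP ->.
have cn : c \notin [set a; b; d] by rewrite !inE !negb_or (eq_sym c a) (eq_sym c b) ac bc cd.
have en : e \notin [set a; b; d].
  by rewrite !inE !negb_or (eq_sym e a) (eq_sym e b) (eq_sym e d) ae be de.
case: cl => cl.
- have [|x [xc xn xK]] := other K c cl; first by rewrite set4_swap34.
  have xe : x != e.
    apply: contraNneq nde => ex; move: xK; rewrite inE => /andP[h _].
    apply: (faces_down h); last by apply/set0Pn; exists d; rewrite set21.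
    by rewrite subUset !sub1set ex !inE !eqxx ?orbT.
  exists x; split=> //; rewrite tE xK andbT.
  apply/orP; left; apply/andP; split.
    apply: contra xc => h; apply/eqP; apply: (eqT x c _ _ cn h).
    by rewrite !inE eqxx ?orbT.
  apply: contra xe => h; apply/eqP; apply: (eqT x e _ _ en h).
  by rewrite !inE eqxx ?orbT.
- have [|x [xe xn xK']] := other K' e cl; first by rewrite tE eqxx ?orbT.
  have e4 : e \in [set a; b; d; e] by rewrite !inE eqxx ?orbT.
  have [] : [set a; b; d; x] \in tets K /\ [set a; b; d; x] != [set a; b; c; d].
    move: (xK'); rewrite tE => /or4P[/and3P[h1 _ h3] //|h|h|h]; case/negP: xe;
      apply/eqP; apply: (eqT x e _ _ en h); by rewrite !inE eqxx ?orbT.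
  move=> xK xc; exists x; split=> //.
  by apply: contraNneq xc => ->; rewrite set4_swap34.
Qed.

(** The orientations of all five tetrahedra, in terms of that of abcd.  The new ones are
    compared with the old through the outer tetrahedron, then with each other
    through their common faces. *)
Lemma osign_move23 K K' o o' a b c d e : move23 K K' a b c d e ->
  closed_3manifold R K \/ closed_3manifold R K' ->
  consistent_orientation K o -> consistent_orientation K' o' ->
  same_orientation K K' o o' ->
  [/\ osign R o a b c e = - osign R o a b c d,
      osign R o' a b d e = - osign R o a b c d,
      osign R o' b c d e = - osign R o a b c d &
      osign R o' c a d e = - osign R o a b c d].
Proof.
move=> M cl ho ho' so; have tE t := move23_tets t M.
have [t1K t2K] := move23_tetsK M.
case: (M) => U _ _ _ _; have [[ab ac ad ae] [bc bd be] [cd ce] de] := uniq5 U.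
have t3 : [set a; b; d; e] \in tets K' by rewrite tE eqxx ?orbT.
have t4 : [set b; c; d; e] \in tets K' by rewrite tE eqxx ?orbT.
have t5 : [set c; a; d; e] \in tets K' by rewrite tE eqxx ?orbT.
have s12 a' b' c' d' L oL : consistent_orientation L oL ->
    [set a'; b'; c'; d'] \in tets L -> osign R oL b' a' c' d' = - osign R oL a' b' c' d'.
  by move=> h h'; case: (osign_swap h h').
have s23 a' b' c' d' L oL : consistent_orientation L oL ->
    [set a'; b'; c'; d'] \in tets L -> osign R oL a' c' b' d' = - osign R oL a' b' c' d'.
  by move=> h h'; case: (osign_swap h h').
have s34 a' b' c' d' L oL : consistent_orientation L oL ->
    [set a'; b'; c'; d'] \in tets L -> osign R oL a' b' d' c' = - osign R oL a' b' c' d'.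
  by move=> h h'; case: (osign_swap h h').
have [x [xc xe xK xK']] := move23_outer_tet M cl.
have e3 : osign R o' a b d e = - osign R o a b c d.
  rewrite (osign_face ho' xK' t3 xe).
  have -> : osign R o' a b d x = osign R o a b d x by rewrite /osign (so _ _ _ _ xK xK').
  have t1K' : [set a; b; d; c] \in tets K by rewrite set4_swap34.
  by rewrite (osign_face ho t1K' xK) 1?eq_sym // opprK (s34 _ _ _ _ _ _ ho t1K).
have adeb : osign R o' a d e b = osign R o' a b d e.
  rewrite (s34 a d b e _ _ ho'); last by rewrite set4_swap23.
  by rewrite (s23 a b d e _ _ ho') ?opprK.
have bdea : osign R o' b d e a = - osign R o' a b d e.
  rewrite (s34 b d a e _ _ ho'); last by rewrite set4_swap23 set4_swap12.
  rewrite (s23 b a d e _ _ ho'); last by rewrite set4_swap12.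
  by rewrite (s12 a b d e _ _ ho') ?opprK.
have bdec : osign R o' b d e c = osign R o' b c d e.
  rewrite (s34 b d c e _ _ ho'); last by rewrite set4_swap23.
  by rewrite (s23 b c d e _ _ ho') ?opprK.
have adec : osign R o' a d e c = - osign R o' c a d e.
  rewrite (s34 a d c e _ _ ho'); last by rewrite set4_swap23 set4_swap12.
  rewrite (s23 a c d e _ _ ho'); last by rewrite set4_swap12.
  by rewrite (s12 c a d e _ _ ho') ?opprK.
have mbdea : [set b; d; e; a] \in tets K'.
  by rewrite set4_swap34 set4_swap23 set4_swap12.
have mbdec : [set b; d; e; c] \in tets K' by rewrite set4_swap34 set4_swap23.
have madeb : [set a; d; e; b] \in tets K' by rewrite set4_swap34 set4_swap23.
have madec : [set a; d; e; c] \in tets K'.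
  by rewrite set4_swap34 set4_swap23 set4_swap12.
split=> //.
- by rewrite (osign_face ho t1K t2K de).
- by rewrite -bdec (osign_face ho' mbdea mbdec ac) bdea opprK.
- apply: oppr_inj; rewrite -adec (osign_face ho' madeb madec bc) adeb e3.
  by rewrite opprK.
Qed.

Lemma osign_sq o a b c d : `|osign R o a b c d| = 1.
Proof. by rewrite /osign; case: ifP; rewrite ?normrN normr1. Qed.

(** The move adds a matrix of rank one. *)
Lemma domega_move23 K K' o o' p a b c d e : move23 K K' a b c d e ->
  closed_3manifold R K \/ closed_3manifold R K' ->
  consistent_orientation K o -> consistent_orientation K' o' ->
  same_orientation K K' o o' -> permitted K p -> permitted K' p ->
  stress_prod p a b c d e != 0 /\ (forall j k, j \in edges K' -> k \in edges K' ->
  domega K' o' p j k = domega K o p j k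
    + osign R o a b c d / stress_prod p a b c d e
      * stress p (unit_dl R j) a b c d e * stress p (unit_dl R k) a b c d e).
Proof.
move=> M cl ho ho' so hp hp'; have tE t := move23_tets t M.
have [t1K t2K] := move23_tetsK M.
case: (M) => U _ _ _ _; have [[ab ac ad ae] [bc bd be] [cd ce] de] := uniq5 U.
have t3 : [set a; b; d; e] \in tets K' by rewrite tE eqxx ?orbT.
have t4 : [set b; c; d; e] \in tets K' by rewrite tE eqxx ?orbT.
have t5 : [set c; a; d; e] \in tets K' by rewrite tE eqxx ?orbT.
have uK (x y z w : V) L : [set x; y; z; w] \in tets L -> uniq [:: x; y; z; w].
  by move=> h; rewrite -card_set4 (tets_card h).
have D1 := permitted_sdet hp (uK _ _ _ _ _ t1K) t1K.
have D2 := permitted_sdet hp (uK _ _ _ _ _ t2K) t2K.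
have D3 := permitted_sdet hp' (uK _ _ _ _ _ t3) t3.
have D4 := permitted_sdet hp' (uK _ _ _ _ _ t4) t4.
have D5 := permitted_sdet hp' (uK _ _ _ _ _ t5) t5.
have S0 : stress_prod p a b c d e != 0.
  by rewrite /stress_prod !mulf_neq0 // -oppr_eq0 -sdet12.
split=> // j k jE kE.
have [s2 s3 s4 s5] := osign_move23 M cl ho ho' so.
have bdE : bd_row p j (unit_dl R k) a b c d e =
    stress p (unit_dl R j) a b c d e * stress p (unit_dl R k) a b c d e
    / stress_prod p a b c d e.
  have [jin|jout] := boolP (j \subset [set a; b; c; d; e]).
    have h : bd_rowP p j (unit_dl R k) a b c d e.
      by apply: bd_row_edge => //; apply: edges_card jE.
    exact: h.
  rewrite stress_out // !mul0r /bd_row /tet_row.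
  have nin (x y z w : V) : [set x; y; z; w] \subset [set a; b; c; d; e] ->
      j \subset [set x; y; z; w] = false.
    by move=> h; apply: contraNF jout => h'; apply: fintype.subset_trans h' h.
  rewrite !nin ?subr0 ?addr0 // !subUset !sub1set !inE !eqxx ?orbT //.
have j2 := edges_card jE.
have dE L oL : permitted L p -> domega L oL p j k = \sum_(t in tets L)
    (if j \subset t then tet_sign oL p t * ddih_at p (unit_dl R k) j t else 0).
  by move=> hL; rewrite domegaE // big_mkcondr.
rewrite (dE K' o' hp') (dE K o hp) (move23_sum M (f := fun t =>
  if j \subset t then tet_sign o p t * ddih_at p (unit_dl R k) j t else 0)); last first.
  move=> t tK tK'; case: ifP => // jt; congr (_ * _).
  have [x [y [z [w [U' _ et]]]]] := edge_tet_labelling j2 (tets_card tK) jt.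
  subst t; have D0 := permitted_sdet hp U' tK.
  by rewrite (tet_signE ho U' tK D0) (tet_signE ho' U' tK' D0) /osign (so _ _ _ _ tK tK').
have rowE L oL x y z w : consistent_orientation L oL -> [set x; y; z; w] \in tets L ->
    sdet p x y z w != 0 ->
    (if j \subset [set x; y; z; w]
     then tet_sign oL p [set x; y; z; w] * ddih_at p (unit_dl R k) j [set x; y; z; w]
     else 0) = - (osign R oL x y z w * tet_row p j (unit_dl R k) x y z w).
  move=> h1 h2 h3; rewrite /tet_row; case: ifP => _; last by rewrite mulr0 oppr0.
  by rewrite (tet_signE h1 (sdet_uniq h3) h2 h3) mulNr mulrA.
rewrite !(rowE K o) ?(rowE K' o') // s2 s3 s4 s5.
have -> : osign R o a b c d / stress_prod p a b c d e *
   stress p (unit_dl R j) a b c d e * stress p (unit_dl R k) a b c d e =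
   osign R o a b c d * bd_row p j (unit_dl R k) a b c d e by rewrite bdE; ring.
rewrite /bd_row (tet_row12 _ _ _ a c d e); ring.
Qed.
End MoveMatrix.

(** * Complementary minors of a symmetric matrix and its kernel *)

Section ComplementaryMinors.
Variables (R : realFieldType) (T : eqType) (r m : nat).
Variables (a : T -> T -> R) (w : 'I_m -> T -> R).
Implicit Types (s t : (r + m).-tuple T).

Let rows s : 'M[R]_(m, r + m) := \matrix_(i, j) w i (tnth s j).
Let cols s t : 'M[R]_(r + m, r) := \matrix_(i, j) a (tnth s i) (tnth t (lshift m j)).
Let minor s t : 'M[R]_r :=
  \matrix_(i, j) a (tnth s (lshift m i)) (tnth t (lshift m j)).
Let cominor s : 'M[R]_m := \matrix_(i, j) w i (tnth s (rshift r j)).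
Let gramW s : 'M[R]_m := rows s *m (rows s)^T.

Lemma gramW_perm s t : perm_eq s t -> gramW s = gramW t.
Proof.
move=> st; apply/matrixP => i j; rewrite !mxE.
under eq_bigr do rewrite !mxE; under [RHS]eq_bigr do rewrite !mxE.
by rewrite -!(big_tuple _ _ _ xpredT (fun x => w i x * w j x)); apply: perm_big.
Qed.

Lemma det_row_mx_perm s t u : perm_eq s t ->
  `|\det (row_mx (cols s u) (rows s)^T)| = `|\det (row_mx (cols t u) (rows t)^T)|.
Proof.
move=> /tuple_permP[p ep].
have -> : row_mx (cols s u) (rows s)^T =
    row_perm p (row_mx (cols t u) (rows t)^T).
  have e i : tnth s i = tnth t (p i).
    have -> : s = [tuple tnth t (p i) | i < r + m] by apply: val_inj.
    by rewrite tnth_mktuple.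
  by apply/matrixP => i j; rewrite !mxE; case: (fintype.split j) => k; rewrite !mxE e.
by rewrite row_permE det_mulmx det_perm normrM normrX normrN1 expr1n mul1r.
Qed.

(** The determinants of the block triangular product [e_s; W] [A e_t | W^T]. *)
Lemma det_cominor_mul s t :
  (forall i x, x \in t -> \sum_(y <- s) w i y * a y x = 0) ->
  \det (cominor s) * \det (row_mx (cols s t) (rows s)^T) =
  \det (minor s t) * \det (gramW s).
Proof.
move=> wa0; have lE : lsubmx (rows s) = \matrix_(i, j) w i (tnth s (lshift m j)).
  by apply/matrixP => i j; rewrite !mxE.
have -> : cominor s = rsubmx (rows s) by apply/matrixP => i j; rewrite !mxE.
have -> : \det (rsubmx (rows s)) =
    \det (block_mx (1%:M : 'M[R]_r) 0 (lsubmx (rows s)) (rsubmx (rows s))).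
  by rewrite det_lblock det1 mul1r.
rewrite -det_mulmx /block_mx hsubmxK mul_col_row -/(block_mx _ _ _ _).
have -> : rows s *m cols s t = 0.
  apply/matrixP => i j; rewrite !mxE; under eq_bigr do rewrite !mxE.
  rewrite -(big_tuple _ _ _ xpredT (fun y => w i y * a y (tnth t (lshift m j)))).
  by rewrite wa0 ?mem_tnth.
rewrite det_ublock -/(gramW s); congr (\det _ * _).
rewrite -[cols s t]vsubmxK mul_row_col mul1mx mul0mx addr0.
by apply/matrixP => i j; rewrite !mxE.
Qed.

(** The rows of W are linearly dependent when their Gram determinant vanishes, and then
    so do the maximal minors of W. *)
Lemma gramW_eq0 s : \det (gramW s) = 0 -> \det (cominor s) = 0.
Proof.
move=> /eqP/det0P[u u0 uG].
have uW : u *m rows s = 0.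
  have : (u *m rows s) *m (u *m rows s)^T = 0.
    by rewrite trmx_mul -mulmxA (mulmxA (rows s)) mulmxA uG mul0mx.
  move=> /matrixP /(_ 0 0); rewrite !mxE; under eq_bigr do rewrite [_^T _ _]mxE.
  move=> /eqP; rewrite psumr_eq0 => [/allP h|i _]; last by rewrite -expr2 sqr_ge0.
  apply/rowP => j; have := h j; rewrite mem_index_enum mulf_eq0 orbb => /(_ isT) /eqP ->.
  by rewrite mxE.
apply/eqP/det0P; exists u => //; apply/rowP => j.
have := congr1 (fun M : 'rV_(r + m) => M 0 (rshift r j)) uW.
rewrite /= !mxE => e; rewrite -[RHS]e.
by apply: eq_bigr => i _; rewrite !mxE.
Qed.

(** Principal minors of a symmetric matrix are proportional to the squares of the
    complementary minors of rows in its kernel.  Each of [s] and [t] lists the index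
    set of a principal minor first, then its complement. *)
Lemma minor_cominor s t : perm_eq s t -> (forall x y, x \in s -> y \in s -> a x y = a y x) ->
  (forall i x, x \in s -> \sum_(y <- s) w i y * a y x = 0) ->
  `|\det (minor s s)| * \det (cominor t) ^+ 2 =
  `|\det (minor t t)| * \det (cominor s) ^+ 2.
Proof.
move=> st asym wa0.
have sumt i x : \sum_(y <- t) w i y * a y x = \sum_(y <- s) w i y * a y x.
  by apply/esym/perm_big.
have memt x : (x \in t) = (x \in s) by rewrite (perm_mem st).
have gst := gramW_perm st.
have [g0|g0] := eqVneq (\det (gramW s)) 0.
  rewrite (gramW_eq0 g0) (@gramW_eq0 t) -?gst //.
  by rewrite expr0n /= !mulr0.
have kers u : u \in [:: s; t] -> forall i x, x \in u -> \sum_(y <- s) w i y * a y x = 0.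
  by move=> ut i x; rewrite !inE in ut; case/orP: ut => /eqP ->; rewrite ?memt; apply: wa0.
have D u v : u \in [:: s; t] -> v \in [:: s; t] ->
    \det (cominor u) * \det (row_mx (cols u v) (rows u)^T) =
    \det (minor u v) * \det (gramW s).
  move=> us vs; have -> : gramW s = gramW u.
    by move: us; rewrite !inE => /orP[] /eqP ->.
  apply: det_cominor_mul => i x xv.
  by move: us; rewrite !inE => /orP[] /eqP ->; rewrite ?sumt; apply: kers xv.
have [hs ht] : s \in [:: s; t] /\ t \in [:: s; t] by rewrite !inE !eqxx orbT.
have mT : \det (minor s t) = \det (minor t s).
  rewrite -det_tr; congr (\det _); apply/matrixP => i j; rewrite !mxE.
  by apply: asym; first [by rewrite mem_tnth | by rewrite -memt mem_tnth].
pose n u v := `|\det (minor u v)|; pose c u := `|\det (cominor u)|.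
have key u v v' : u \in [:: s; t] -> v \in [:: s; t] -> v' \in [:: s; t] ->
    c u * n v v' = c v * n u v'.
  move=> us vs v's.
  have st' : perm_eq u v.
    move: us vs; rewrite !inE => /orP[] /eqP -> /orP[] /eqP ->; rewrite ?perm_refl //.
    by rewrite perm_sym.
  have du := congr1 Num.norm (D u v' us v's); have dv := congr1 Num.norm (D v v' vs v's).
  rewrite !normrM -(det_row_mx_perm v' st') in dv; rewrite !normrM in du.
  have g0' : `|\det (gramW s)| != 0 by rewrite normr_eq0.
  apply: (mulIf g0'); rewrite -!mulrA /n -du -dv /c; ring.
have k1 := key t s s ht hs hs; have k2 := key s t t hs ht ht.
have nst : n s t = n t s by rewrite /n mT.
have sq u : c u ^+ 2 = \det (cominor u) ^+ 2 by rewrite real_normK ?num_real.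
rewrite -!sq -/(n s s) -/(n t t) !expr2.
transitivity (c t * n s s * c t); first ring.
rewrite k1 -mulrA -nst.
transitivity (c s * (n s t * c t)); first ring.
by rewrite [n s t * _]mulrC -k2; ring.
Qed.
End ComplementaryMinors.

(** * Minors and ranks for matrices indexed by sets *)

Section IndexedMinors.
Variables (R : realType) (V : finType).
Let T := {set V}.
Implicit Types (a : T -> T -> R) (b : T -> R) (C D E : {set T}) (x : T).

Lemma wedgeE C n (w : 'I_n -> T -> R) : #|C| = n ->
  wedge C w = \det (\matrix_(i < n, j < n) w i (nth set0 (enum C) j)).
Proof.
move=> cn; congr (\det _); apply/matrixP => i j; rewrite !mxE.
by rewrite (nth_map set0) // -cardE cn.
Qed.

Lemma det_mxonE C n a : #|C| = n ->
  \det (mxon C a) =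
  \det (\matrix_(i < n, j < n) a (nth set0 (enum C) i) (nth set0 (enum C) j)).
Proof.
move=> cn; case: n / cn; congr (\det _); apply/matrixP => i j; rewrite !mxE.
by rewrite !(enum_val_nth set0).
Qed.

Lemma perm_enum_setD C E : C \subset E ->
  perm_eq (enum C ++ enum (E :\: C)) (enum E).
Proof.
move=> CE; apply: uniq_perm.
- rewrite cat_uniq !enum_uniq andbT /=; apply/hasPn => x.
  by rewrite !mem_enum inE => /andP[].
- exact: enum_uniq.
- move=> x; rewrite mem_cat !mem_enum inE.
  by case: (boolP (x \in C)) => //= /(fintype.subsetP CE) ->.
Qed.

(** [minor_cominor] for matrices indexed by the elements of [E]. *)
Lemma det_mxon_wedge a E C D n (w : 'I_n -> T -> R) :
  C \subset E -> D \subset E -> #|E :\: C| = n -> #|E :\: D| = n ->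
  {in E &, forall x y, a x y = a y x} ->
  (forall i x, x \in E -> \sum_(y in E) a x y * w i y = 0) ->
  `|\det (mxon C a)| * wedge (E :\: D) w ^+ 2 =
  `|\det (mxon D a)| * wedge (E :\: C) w ^+ 2.
Proof.
move=> CE DE cC cD asym aw0.
have cDC : #|D| = #|C|.
  have e1 := cardsID C E; have e2 := cardsID D E.
  rewrite (setIidPr CE) cC in e1; rewrite (setIidPr DE) cD in e2.
  by apply: (@addIn n); rewrite e1 e2.
pose r := #|C|.
have sz (B : {set T}) : #|B| = r -> #|E :\: B| = n ->
    size (enum B ++ enum (E :\: B)) == (r + n)%N.
  by move=> h1 h2; rewrite size_cat -!cardE h1 h2.
pose s := Tuple (sz C erefl cC); pose t := Tuple (sz D cDC cD).
have ls (B : {set T}) (h1 : #|B| = r) (h2 : #|E :\: B| = n) (i : 'I_r) :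
    tnth (Tuple (sz B h1 h2)) (lshift n i) = nth set0 (enum B) i.
  by rewrite (tnth_nth set0) /= nth_cat -cardE h1 ltn_ord.
have rs (B : {set T}) (h1 : #|B| = r) (h2 : #|E :\: B| = n) (i : 'I_n) :
    tnth (Tuple (sz B h1 h2)) (rshift r i) = nth set0 (enum (E :\: B)) i.
  by rewrite (tnth_nth set0) /= nth_cat -cardE h1 ltnNge leq_addr /= addKn.
have mC := perm_enum_setD CE; have mD := perm_enum_setD DE.
have st : perm_eq s t by rewrite (perm_trans mC) // perm_sym.
have memE x : (x \in s) = (x \in E) by rewrite (perm_mem mC) mem_enum.
have := @minor_cominor R T r n a w s t st.
have h1 x y : x \in s -> y \in s -> a x y = a y x by rewrite !memE; apply: asym.
have h2 i x : x \in s -> \sum_(y <- s) w i y * a y x = 0.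
  rewrite memE => xE; rewrite (perm_big _ mC) /= big_enum_cond /= -[RHS](aw0 i x xE).
  apply: eq_big => [y|y /andP[yE _]]; first by rewrite andbT.
  by rewrite mulrC asym.
move=> /(_ h1 h2); rewrite (det_mxonE a (erefl : #|C| = r)) (det_mxonE a cDC).
rewrite (wedgeE w cC) (wedgeE w cD).
have e1 : \matrix_(i < r, j < r) a (tnth s (lshift n i)) (tnth s (lshift n j)) =
   \matrix_(i, j) a (nth set0 (enum C) i) (nth set0 (enum C) j).
  by apply/matrixP => i j; rewrite !mxE !ls.
have e2 : \matrix_(i < r, j < r) a (tnth t (lshift n i)) (tnth t (lshift n j)) =
   \matrix_(i, j) a (nth set0 (enum D) i) (nth set0 (enum D) j).
  by apply/matrixP => i j; rewrite !mxE !ls.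
have e3 : \matrix_(i < n, j < n) w i (tnth s (rshift r j)) =
   \matrix_(i, j) w i (nth set0 (enum (E :\: C)) j).
  by apply/matrixP => i j; rewrite !mxE !rs.
have e4 : \matrix_(i < n, j < n) w i (tnth t (rshift r j)) =
   \matrix_(i, j) w i (nth set0 (enum (E :\: D)) j).
  by apply/matrixP => i j; rewrite !mxE !rs.
by rewrite e1 e2 e3 e4.
Qed.

(** A matrix indexed by [C] whose nonzero entries lie in [E] has at most the rank of the
    matrix indexed by [E]. *)
Lemma mxon_rank_le a C E :
  {in C &, forall x y, a x y != 0 -> (x \in E) && (y \in E)} ->
  (\rank (mxon C a) <= \rank (mxon E a))%N.
Proof.
move=> aE; pose Q : 'M[R]_(#|C|, #|E|) := \matrix_(i, j) (enum_val i == enum_val j)%:R.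
have -> : mxon C a = Q *m mxon E a *m Q^T.
  have sumQ (F : T -> R) x : \sum_(j < #|E|) (x == enum_val j)%:R * F (enum_val j) =
      (x \in E)%:R * F x.
    rewrite -(big_enum_val (fun y => (x == y)%:R * F y)) /=.
    rewrite big_mkcond (bigD1 x) //= eqxx mul1r big1 ?addr0 => [|y yx].
      by case: (x \in E); rewrite ?mul1r ?mul0r.
    by rewrite eq_sym (negbTE yx) mul0r if_same.
  apply/matrixP => i j; rewrite !mxE.
  under eq_bigr => k _.
    rewrite !mxE; under eq_bigr do rewrite !mxE.
    rewrite (sumQ (fun y => a y (enum_val k))) mulrC.
    over.
  rewrite (sumQ (fun z => (enum_val i \in E)%:R * a (enum_val i) z)).
  have := aE _ _ (enum_valP i) (enum_valP j).
  have [->|_] := eqVneq (a (enum_val i) (enum_val j)) 0; first by rewrite !mulr0.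
  by move=> /(_ isT) /andP[-> ->]; rewrite !mul1r.
by rewrite (leq_trans (mxrankM_maxl _ _)) // mxrankM_maxr.
Qed.

Lemma det_tuple_perm a n (s t : n.-tuple T) : perm_eq s t ->
  \det (\matrix_(i < n, j < n) a (tnth s i) (tnth s j)) =
  \det (\matrix_(i < n, j < n) a (tnth t i) (tnth t j)).
Proof.
move=> /tuple_permP[p ep].
have e i : tnth s i = tnth t (p i).
  have -> : s = [tuple tnth t (p i) | i < n] by apply: val_inj.
  by rewrite tnth_mktuple.
set M := (X in _ = \det X).
have -> : \matrix_(i < n, j < n) a (tnth s i) (tnth s j) = row_perm p (col_perm p M).
  by apply/matrixP => i j; rewrite !mxE !e.
rewrite row_permE col_permE !det_mulmx !det_perm odd_permV.
by rewrite mulrCA -expr2 sqrr_sign mulr1.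
Qed.

(** A symmetric modification of rank one, [a' = a + c b b^T], when [a] vanishes on the
    additional index [x]. *)
Section RankOne.
Variables (a a' : T -> T -> R) (b : T -> R) (c : R) (E : {set T}) (x : T).
Hypotheses (xE : x \notin E) (bx0 : b x != 0) (c0 : c != 0).
Hypothesis a'E : {in x |: E &, forall y z, a' y z = a y z + c * b y * b z}.
Hypothesis ax0 : {in x |: E, forall y, a x y = 0 /\ a y x = 0}.

(** Schur complement. *)
Lemma det_rank1 C : C \subset E ->
  \det (mxon (x |: C) a') = c * b x ^+ 2 * \det (mxon C a).
Proof.
move=> CE; have xC : x \notin C by apply: contra xE; apply/fintype.subsetP.
pose r := #|C|.
have cx : #|x |: C| = (1 + r)%N by rewrite cardsU1 xC.
have sz1 : size (x :: enum C) == (1 + r)%N by rewrite /= -cardE.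
have sz2 : size (enum (x |: C)) == (1 + r)%N by rewrite -cardE cx.
pose s := Tuple sz1; pose t := Tuple sz2.
have ts : perm_eq t s.
  apply: uniq_perm; rewrite ?enum_uniq //= ?mem_enum ?xC ?enum_uniq // => y.
  by rewrite mem_enum !inE mem_enum.
rewrite (det_mxonE a' cx).
transitivity (\det (\matrix_(i < 1 + r, j < 1 + r) a' (tnth t i) (tnth t j))).
  by congr (\det _); apply/matrixP => i j; rewrite !mxE !(tnth_nth set0).
rewrite (det_tuple_perm a' ts).
have s0 (i : 'I_1) : tnth s (lshift r i) = x.
  by rewrite ord1 (tnth_nth set0).
have s1 (i : 'I_r) : tnth s (rshift 1 i) = enum_val i.
  by rewrite (tnth_nth set0) (enum_val_nth set0).
have mE (i : 'I_r) : enum_val i \in x |: E.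
  by rewrite in_setU (fintype.subsetP CE _ (enum_valP i)) orbT.
have xx : x \in x |: E by rewrite setU11.
pose L : 'M[R]_(1 + r) := block_mx 1%:M 0 (\col_i (b (enum_val i) / b x)) 1%:M.
pose U : 'M[R]_(1 + r) :=
  block_mx (c * b x ^+ 2)%:M (\row_j (c * b x * b (enum_val j))) 0 (mxon C a).
have -> : \matrix_(i < 1 + r, j < 1 + r) a' (tnth s i) (tnth s j) = L *m U.
  rewrite /L /U mulmx_block !mul1mx !mul0mx !addr0.
  apply/matrixP => i j; rewrite -[LHS]/(fun_of_matrix _ _ _) mxE.
  rewrite -(fintype.splitK i) -(fintype.splitK j).
  case: (fintype.split i) => i'; case: (fintype.split j) => j' /=.
  - rewrite block_mxEul !s0 a'E // (proj1 (ax0 xx)) !ord1 mxE eqxx mulr1n; ring.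
  - rewrite block_mxEur s0 s1 a'E // (proj1 (ax0 (mE _))) !mxE; ring.
  - rewrite block_mxEdl s0 s1 a'E // (proj2 (ax0 (mE _))) !mxE big_ord1 !mxE.
    by rewrite !ord1 eqxx mulr1n; field.
  - by rewrite block_mxEdr !s1 a'E // !mxE big_ord1 !mxE; field.
by rewrite det_mulmx det_lblock det_ublock !det1 !mul1r det_scalar1.
Qed.

Lemma rank_rank1 C : C \subset E -> \det (mxon C a) != 0 ->
  #|C| = \rank (mxon E a) ->
  \rank (mxon (x |: E) a') = (\rank (mxon E a)).+1.
Proof.
move=> CE d0 cC; apply/eqP; rewrite eqn_leq; apply/andP; split.
  have -> : mxon (x |: E) a' = mxon (x |: E) a +
      (\col_i (c * b (enum_val i))) *m (\row_j b (enum_val j)).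
    apply/matrixP => i j; rewrite !mxE big_ord1 !mxE.
    by rewrite a'E // enum_valP.
  apply: leq_trans (mxrank_add _ _) _; rewrite -[leqRHS]addn1; apply: leq_add.
    apply: mxon_rank_le => y z yE zE; apply: contraR.
    rewrite negb_and => /orP[] nE; apply/eqP.
      by have := yE; rewrite in_setU1 (negbTE nE) orbF => /eqP ->; case: (ax0 zE).
    by have := zE; rewrite in_setU1 (negbTE nE) orbF => /eqP ->; case: (ax0 yE).
  by rewrite (leq_trans (mxrankM_maxl _ _)) // rank_leq_col.
have xC : x \notin C by apply: contra xE; apply/fintype.subsetP.
have <- : \rank (mxon (x |: C) a') = (\rank (mxon E a)).+1.
  rewrite -cC mxrank_unit ?cardsU1 ?xC // unitmxE unitfE det_rank1 //.
  by rewrite !mulf_neq0 // expf_neq0.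
apply: mxon_rank_le => y z yC zC _.
by rewrite !(fintype.subsetP (setUS _ CE)).
Qed.

End RankOne.
End IndexedMinors.

(** * Generic placements *)

Section Generic.
Variables (R : realType) (V : finType).
Implicit Types (p q : V -> 'rV[R]_3).
Let N := #|{: V * 'I_3}|.

(** The restriction of a polynomial to the line through x and y. *)
Definition line_poly (x y : 'I_N -> R) (P : mpoly.mpoly N R) : {poly R} :=
  \sum_(m <- mpoly.msupp P) (mpoly.mcoeff m P)%:P *
    \prod_i ((x i)%:P + (y i - x i)%:P * 'X) ^+ mpoly.fun_of_multinom m i.

Lemma horner_line_poly x y P t :
  (line_poly x y P).[t] = mpoly.meval (fun i => x i + (y i - x i) * t) P.
Proof.
rewrite mpoly.mevalE /line_poly horner_sum; apply: eq_bigr => m _.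
rewrite hornerM hornerC horner_prod; congr (_ * _); apply: eq_bigr => i _.
by rewrite horner_exp !hornerE.
Qed.

Lemma poly_nonroot (f : {poly R}) : f != 0 -> exists t, f.[t] != 0.
Proof.
move=> f0; apply: contrapT => h.
have := @max_poly_roots _ f [seq (i%:R : R) | i <- iota 0 (size f)] f0.
rewrite size_map size_iota ltnn => h'; have : false; last by [].
apply: h'.
  by apply/allP => t _; apply/negPn/negP => nt; apply: h; exists t.
by rewrite map_inj_uniq ?iota_uniq // => i j /eqP; rewrite eqr_nat => /eqP.
Qed.

(** The union of two algebraic sets is defined by the products of their equations. *)
Lemma algebraicU (Z1 Z2 : set (V -> 'rV[R]_3)) : algebraic Z1 -> algebraic Z2 ->
  algebraic (fun p => Z1 p \/ Z2 p).
Proof.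
move=> [m1 [P1 h1]] [m2 [P2 h2]].
exists #|{: 'I_m1 * 'I_m2}|.
exists (fun i => P1 (enum_val i).1 * P2 (enum_val i).2) => p; split.
  move=> [/h1 h|/h2 h] i; rewrite mpoly.mevalM h; [exact: mul0r | exact: mulr0].
move=> h; apply: contrapT => /not_orP[n1 n2].
have [i ni] : exists i, mpoly.meval (placement_coord p) (P1 i) <> 0.
  by apply: contrapT => n; apply/n1/h1 => i; apply: contrapT => ni; apply: n; exists i.
have [j nj] : exists j, mpoly.meval (placement_coord p) (P2 j) <> 0.
  by apply: contrapT => n; apply/n2/h2 => j; apply: contrapT => nj; apply: n; exists j.
have := h (enum_rank (i, j)); rewrite enum_rankK mpoly.mevalM /= => /eqP.
by rewrite mulf_eq0 => /orP[] /eqP.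
Qed.

(** Two nonempty Zariski open sets of placements intersect: the line through a point of
    each leaves each of them at finitely many points only. *)
Lemma generic_inhabited2 (Z1 Z2 : set (V -> 'rV[R]_3)) : algebraic Z1 -> algebraic Z2 ->
  (exists p, ~ Z1 p) -> (exists p, ~ Z2 p) -> exists p, ~ (Z1 p \/ Z2 p).
Proof.
move=> [m1 [P1 h1]] [m2 [P2 h2]] [p np] [q nq].
have [i ni] : exists i, mpoly.meval (placement_coord p) (P1 i) <> 0.
  by apply: contrapT => n; apply/np/h1 => i; apply: contrapT => ni; apply: n; exists i.
have [j nj] : exists j, mpoly.meval (placement_coord q) (P2 j) <> 0.
  by apply: contrapT => n; apply/nq/h2 => j; apply: contrapT => nj; apply: n; exists j.
pose x := placement_coord p; pose y := placement_coord q.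
have x0 : line_poly x y (P1 i) != 0.
  apply: contra_notN ni => /eqP h; have := horner_line_poly x y (P1 i) 0.
  have e : (fun k => x k + (y k - x k) * 0) =1 x by move=> k; rewrite mulr0 addr0.
  by rewrite h horner0 (mpoly.meval_eq _ e) => /esym.
have y0 : line_poly x y (P2 j) != 0.
  apply: contra_notN nj => /eqP h; have := horner_line_poly x y (P2 j) 1.
  have e : (fun k => x k + (y k - x k) * 1) =1 y by move=> k; rewrite mulr1 addrC subrK.
  by rewrite h horner0 (mpoly.meval_eq _ e) => /esym.
have [t] := poly_nonroot (mulf_neq0 x0 y0).
rewrite hornerM mulf_eq0 negb_or !horner_line_poly => /andP[t1 t2].
pose pt v := p v + t *: (q v - p v).
have e k : placement_coord pt k = x k + (y k - x k) * t.
  by rewrite /placement_coord /pt !mxE mulrC.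
exists pt => -[/h1 /(_ i)|/h2 /(_ j)]; rewrite (mpoly.meval_eq _ e) => /eqP.
  by rewrite (negbTE t1).
by rewrite (negbTE t2).
Qed.

Lemma generically2 (Q1 Q2 Q : (V -> 'rV[R]_3) -> Prop) :
  generically Q1 -> generically Q2 -> (forall p, Q1 p -> Q2 p -> Q p) ->
  generically Q.
Proof.
move=> [Z1 [a1 n1 h1]] [Z2 [a2 n2 h2]] h.
exists (fun p => Z1 p \/ Z2 p); split; first exact: algebraicU.
  exact: generic_inhabited2.
by move=> p /not_orP[np1 np2]; apply: h; [apply: h1 | apply: h2].
Qed.

End Generic.

(** * Invariance of the form *)

Section Forms.
Variables (R : realType) (V : finType).
Implicit Types (K : scomplex V) (o : orientation V) (p : V -> 'rV[R]_3).
Implicit Types (C D : {set {set V}}) (a b c d e : V) (j k : {set V}).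

Lemma card_compl K C p o : C \subset edges K -> #|C| = \rank (Amx K o p) ->
  #|edges K :\: C| = zero_curv_dim K o p.
Proof.
by move=> CE cC; rewrite cardsD (setIidPr CE) cC /zero_curv_dim mxrank_coker.
Qed.

Lemma abs_formE K o C p n (w : 'I_n -> {set V} -> R) :
  Defs.form K o C p w = `|\prod_(i in edges K) len p i| *
    (`|wedge (edges K :\: C) w| / Num.sqrt `|fdet K o p C|)
    / Num.sqrt (\prod_(t in tets K) (6 * vol p t)).
Proof.
rewrite /Defs.form normf_div normrM sqrtrM // [X in _ / X]ger0_norm ?mulr_ge0 //.
by rewrite invfM !mulrA.
Qed.

(** Independence of the set of edges, at one placement. *)
Lemma form_admissible K o C D p n (w : 'I_n -> {set V} -> R) :
  permitted K p -> C \subset edges K -> D \subset edges K ->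
  #|edges K :\: C| = n -> #|edges K :\: D| = n ->
  fdet K o p C != 0 -> fdet K o p D != 0 ->
  (forall i, zero_curv K o p (w i)) ->
  Defs.form K o C p w = Defs.form K o D p w.
Proof.
move=> hp CE DE cC cD fC fD hw; rewrite !abs_formE; congr (_ * _ / _).
have asym : {in edges K &, forall x y, domega K o p x y = domega K o p y x}.
  by move=> x y; apply: domega_sym.
have := det_mxon_wedge CE DE cC cD asym (fun i x => hw i x).
rewrite -/(fdet K o p C) -/(fdet K o p D).
move: (wedge _ _) (wedge _ _) => wD wC /(congr1 Num.sqrt).
rewrite (sqrtrM _ (normr_ge0 _)) sqrtr_sqr (sqrtrM _ (normr_ge0 _)) sqrtr_sqr => h.
have sC : Num.sqrt `|fdet K o p C| != 0 by rewrite gt_eqF // sqrtr_gt0 normr_gt0.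
have sD : Num.sqrt `|fdet K o p D| != 0 by rewrite gt_eqF // sqrtr_gt0 normr_gt0.
by apply/eqP; rewrite eqr_div // mulrC -h mulrC.
Qed.

Lemma same_form_admissible K o C D :
  admissible R K o C -> admissible R K o D -> same_form R K o C D.
Proof.
move=> [CE gC] [DE gD]; apply: (generically2 gC gD) => p hC hD hp n.
have [fC cC] := hC hp; have [fD cD] := hD hp.
have nC := card_compl CE cC; have nD := card_compl DE cD.
by split=> // v hv; apply: form_admissible.
Qed.

(** The move at one placement: [st] is the vector s and [co] the constant c with
    A' = A + c s s^T. *)
Section MovePoint.
Variables (K K' : scomplex V) (o o' : orientation V) (p : V -> 'rV[R]_3).
Variables (a b c d e : V).
Hypothesis M : move23 K K' a b c d e.
Hypothesis cl : closed_3manifold R K \/ closed_3manifold R K'.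
Hypotheses (ho : consistent_orientation K o) (ho' : consistent_orientation K' o').
Hypothesis so : same_orientation K K' o o'.
Hypotheses (hp : permitted K p) (hp' : permitted K' p).

Let st k := stress p (unit_dl R k) a b c d e.
Let co := osign R o a b c d / stress_prod p a b c d e.
Let de := [set d; e].

Lemma stress_new : st de =
  - sdet p a b c e * sdet p a b c d * len p [set d; e].
Proof.
case: M => U _ _ _ _; have [[ab ac ad ae] [bc bd be] [cd ce] nde] := uniq5 U.
rewrite /st /de /stress /unit_dl /= eqxx.
have -> : ([set a; b] == [set d; e]) = false by rewrite set2_neql.
have -> : ([set a; c] == [set d; e]) = false by rewrite set2_neql.
have -> : ([set a; d] == [set d; e]) = false by rewrite set2_neql.
have -> : ([set a; e] == [set d; e]) = false by rewrite set2_neql.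
have -> : ([set b; c] == [set d; e]) = false by rewrite set2_neql.
have -> : ([set b; d] == [set d; e]) = false by rewrite set2_neql.
have -> : ([set b; e] == [set d; e]) = false by rewrite set2_neql.
have -> : ([set c; d] == [set d; e]) = false by rewrite set2_neql.
have -> : ([set c; e] == [set d; e]) = false by rewrite set2_neql.
by rewrite /= !mulr0n !mulr1n; ring.
Qed.

Lemma move_neq0 : [/\ stress_prod p a b c d e != 0, co != 0, st de != 0
  & 0 < len p de].
Proof.
have [S0 _] := domega_move23 M cl ho ho' so hp hp'.
have [_ _ D3 D4 D5] := stress_prod_neq0 S0.
have D3' : sdet p d e a b != 0.
  rewrite (sdet23 p d a e b) oppr_eq0 (sdet12 p a d e b) oppr_eq0.
  rewrite (sdet34 p a d b e) oppr_eq0 (sdet23 p a b d e) oppr_eq0 //.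
have l0 : 0 < len p de by apply: (len_gt0 (sdet_uniq D3') D3').
split=> //.
  rewrite /co mulf_neq0 ?invr_eq0 // -normr_eq0 osign_sq oner_eq0 //.
by rewrite stress_new !mulf_neq0 ?oppr_eq0 // gt_eqF.
Qed.

Lemma domega_new0 j : j \in edges K' ->
  domega K o p de j = 0 /\ domega K o p j de = 0.
Proof.
move=> jE; have [eE deE] := move23_edges M.
have de2 : #|de| = 2%N by apply: (@edges_card _ K'); rewrite eE setU11.
have nt t : t \in tets K -> ~~ (de \subset t).
  move=> tK; apply: contra deE => ht; rewrite inE -/de de2 eqxx andbT.
  move: tK; rewrite inE => /andP[h _].
  by apply: (faces_down h ht); apply/set0Pn; exists d; rewrite set21.
split; rewrite domegaE ?(edges_card jE) //; apply: big1 => t /andP[tK jt].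
  by move: (nt t tK); rewrite jt.
by rewrite ddih_at_out ?mulr0 ?(edges_card jE) ?(tets_card tK) ?nt.
Qed.

Lemma domega_new j k : j \in edges K' -> k \in edges K' ->
  domega K' o' p j k = domega K o p j k + co * st j * st k.
Proof. by move=> jE kE; have [_ ->] := domega_move23 M cl ho ho' so hp hp'. Qed.

Lemma zero_curv_move v : zero_curv K' o' p v <->
  zero_curv K o p v /\ \sum_(k in edges K') st k * v k = 0.
Proof.
have [eE deE] := move23_edges M; have [S0 co0 st0 _] := move_neq0.
have deE' : de \in edges K' by rewrite eE setU11.
set B := \sum_(k in edges K') _.
have rowE j : j \in edges K' -> \sum_(k in edges K') domega K' o' p j k * v k =
    \sum_(k in edges K) domega K o p j k * v k + co * st j * B.
  move=> jE; rewrite mulr_sumr.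
  have -> : \sum_(k in edges K) domega K o p j k * v k =
      \sum_(k in edges K') domega K o p j k * v k.
    by rewrite eE big_setU1 //= (proj2 (domega_new0 jE)) mul0r add0r.
  rewrite -big_split /=; apply: eq_bigr => k kE.
  by rewrite domega_new // mulrDl !mulrA.
have row0 : \sum_(k in edges K) domega K o p de k * v k = 0.
  apply: big1 => k kE; rewrite (proj1 (domega_new0 _)) ?mul0r //.
  by rewrite eE in_setU kE orbT.
split=> [h|[h B0] j jE].
  have B0 : B = 0.
    have := h _ deE'; rewrite rowE // row0 add0r => /eqP.
    by rewrite mulf_eq0 (negbTE (mulf_neq0 co0 st0)) => /eqP.
  split=> // j jE; have jE' : j \in edges K' by rewrite eE in_setU jE orbT.
  by have := h j jE'; rewrite rowE // B0 mulr0 addr0.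
rewrite rowE // B0 mulr0 addr0; move: jE; rewrite eE in_setU1 => /orP[/eqP ->|] //.
exact: h.
Qed.

Lemma zero_curv_extend v : zero_curv K o p v ->
  exists! x, zero_curv K' o' p (upd v de x).
Proof.
have [eE deE] := move23_edges M; have [S0 co0 st0 _] := move_neq0.
move=> hv; have updE x k : k \in edges K -> upd v de x k = v k.
  by move=> kE; rewrite /upd; case: eqP => // ek; move: deE; rewrite -/de -ek kE.
have sumE x : \sum_(k in edges K') st k * upd v de x k =
    st de * x + \sum_(k in edges K) st k * v k.
  rewrite eE big_setU1 //= {1}/upd eqxx; congr (_ + _).
  by apply: eq_bigr => k kE; rewrite updE.
have hupd x : zero_curv K o p (upd v de x).
  by move=> j jE; rewrite -[RHS](hv j jE); apply: eq_bigr => k kE; rewrite updE.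
set s := \sum_(k in edges K) _ in sumE.
exists (- s / st de); split.
  by apply/zero_curv_move; split=> //; rewrite sumE; field.
move=> x /zero_curv_move[_]; rewrite sumE => /eqP; rewrite addr_eq0 => /eqP <-.
by rewrite mulrC mulKf.
Qed.

Variables (C : {set {set V}}).
Hypotheses (CE : C \subset edges K) (fC : fdet K o p C != 0).
Hypothesis cC : #|C| = \rank (Amx K o p).

Lemma fdet_move : fdet K' o' p (de |: C) = co * st de ^+ 2 * fdet K o p C.
Proof.
have [eE deE] := move23_edges M; have [S0 co0 st0 _] := move_neq0.
apply: (det_rank1 (E := edges K)) => //; rewrite -/de -eE.
  by move=> j k jE kE; apply: domega_new.
by move=> j jE; apply: domega_new0.
Qed.

Lemma rank_move : \rank (Amx K' o' p) = (\rank (Amx K o p)).+1.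
Proof.
have [eE deE] := move23_edges M; have [S0 co0 st0 _] := move_neq0.
rewrite /Amx eE; apply: (rank_rank1 deE st0 co0 _ _ CE fC cC); rewrite -/de -eE.
  by move=> j k jE kE; apply: domega_new.
by move=> j jE; apply: domega_new0.
Qed.

Lemma zero_curv_dim_move : zero_curv_dim K' o' p = zero_curv_dim K o p.
Proof.
have [eE deE] := move23_edges M.
by rewrite /zero_curv_dim !mxrank_coker rank_move eE cardsU1 deE add1n subSS.
Qed.

Lemma edges_compl_move : edges K' :\: (de |: C) = edges K :\: C.
Proof.
have [-> deE] := move23_edges M; apply/setP => k; rewrite !in_setD !in_setU1.
have [->|//] := eqVneq k de; by rewrite (negbTE deE) andbF.
Qed.

(** [C] with the new edge added is a possible choice after the move, and with it the
    changes of the factors of the form cancel. *)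
Lemma form_move n (w : 'I_n -> {set V} -> R) :
  Defs.form K o C p w = Defs.form K' o' (de |: C) p w.
Proof.
have [eE deE] := move23_edges M; have [S0 co0 st0 l0] := move_neq0.
rewrite !abs_formE edges_compl_move fdet_move eE big_setU1 //= -/de.
have [x] := move23_big *%R M (f := fun t => 6 * vol p t)
  (f' := fun t => 6 * vol p t) (fun _ _ _ => erefl).
rewrite /= => -[-> ->].
have [t1K t2K] := move23_tetsK M; have tE t := move23_tets t M.
have [D4 D5 D3 D2 D1] := stress_prod_neq0 S0.
have D5' : sdet p c a d e != 0 by rewrite sdet12 oppr_eq0.
rewrite !volE ?(sdet_uniq D1) ?(sdet_uniq D2) ?(sdet_uniq D3) ?(sdet_uniq D4)
  ?(sdet_uniq D5') //.
have six y : 6 * (y / 6) = y :> R by field.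
rewrite !six.
set P := Num.sqrt (`|sdet p a b c d| * _); set P' := Num.sqrt (`|sdet p a b d e| * _).
have eP : Num.sqrt `|co * st de ^+ 2| * P' = len p de * P.
  transitivity (Num.sqrt (len p de ^+ 2) * P); last by rewrite sqrtr_sqr gtr0_norm.
  rewrite /P /P' -(sqrtrM _ (normr_ge0 _)) -(sqrtrM _ (sqr_ge0 _)).
  congr Num.sqrt; rewrite normrM normrX stress_new.
  rewrite /co (normrM (osign _ _ _ _ _ _)) normfV osign_sq /stress_prod !normrM normrN.
  rewrite [`|len p _|]gtr0_norm // (sdet12 p a c) normrN -/de.
  have n1 : `|sdet p a b c d| != 0 by rewrite normr_eq0.
  have n2 : `|sdet p a b c e| != 0 by rewrite normr_eq0.
  have n3 : `|sdet p a b d e| != 0 by rewrite normr_eq0.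
  have n4 : `|sdet p b c d e| != 0 by rewrite normr_eq0.
  have n5 : `|sdet p a c d e| != 0 by rewrite normr_eq0.
  by field; rewrite n1 n2 n3 n4 n5.
have -> : Num.sqrt `|co * st de ^+ 2 * fdet K o p C| =
    Num.sqrt `|co * st de ^+ 2| * Num.sqrt `|fdet K o p C|.
  by rewrite normrM (sqrtrM _ (normr_ge0 _)).
rewrite normrM [`|len p de|]gtr0_norm //.
set f := Num.sqrt `|fdet K o p C|; set g := Num.sqrt `|co * _| in eP *.
transitivity (len p de * `|\prod_(i in edges K) len p i|
    * `|wedge (edges K :\: C) w| / f / (g * P')); last by rewrite !invfM; ring.
rewrite eP [(_ * P)^-1]invfM.
transitivity (len p de / len p de * (`|\prod_(i in edges K) len p i|
    * (`|wedge (edges K :\: C) w| / f) / P)); last by ring.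
by rewrite divff ?mul1r // gt_eqF.
Qed.

End MovePoint.

(** The set after the move is arbitrary: [form_admissible] compares it with [C]
    together with the new edge. *)
Lemma same_form_move K K' o o' C C' a b c d e : move23 K K' a b c d e ->
  closed_3manifold R K \/ closed_3manifold R K' ->
  consistent_orientation K o -> consistent_orientation K' o' ->
  same_orientation K K' o o' -> admissible R K o C -> admissible R K' o' C' ->
  same_form_forget R K o C K' o' C' [set d; e].
Proof.
move=> M cl ho ho' so [CE gC] [CE' gC']; apply: (generically2 gC gC') => p hC hC' hp hp'.
have [fC cC] := hC hp; have [fC' cC'] := hC' hp'.
have [eE deE] := move23_edges M.
have dimE := zero_curv_dim_move M cl ho ho' so hp hp' CE fC cC.
have nC := card_compl CE cC; have := card_compl CE' cC'; rewrite dimE => nC'.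
move=> n; split=> //.
- by move=> v /(zero_curv_move M cl ho ho' so hp hp')[].
- by move=> v; apply: (zero_curv_extend M cl ho ho' so hp hp').
- move=> v hv; rewrite (form_move M cl ho ho' so hp hp' CE).
  have [S0 co0 st0 _] := move_neq0 M cl ho ho' so hp hp'.
  apply: form_admissible => //.
  + by rewrite eE setUS.
  + by rewrite (edges_compl_move M).
  + rewrite (fdet_move M cl ho ho' so hp hp' CE); apply: mulf_neq0 => //.
    by apply: mulf_neq0 => //; apply: expf_neq0.
Qed.

End Forms.

Theorem theorem4 (R : realType) (V : finType) (K : scomplex V) (o : orientation V)
    (hK : closed_3manifold R K) (ho : consistent_orientation K o)
    (C : {set {set V}}) (hC : admissible R K o C) :
  (forall C' : {set {set V}}, admissible R K o C' -> same_form R K o C C') /\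
  (forall (K' : scomplex V) (a b c d e : V) (o' : orientation V) (C' : {set {set V}}),
     move23 K K' a b c d e ->
     consistent_orientation K' o' -> same_orientation K K' o o' ->
     admissible R K' o' C' ->
     same_form_forget R K o C K' o' C' [set d; e]) /\
  (forall (K' : scomplex V) (a b c d e : V) (o' : orientation V) (C' : {set {set V}}),
     move23 K' K a b c d e ->
     consistent_orientation K' o' -> same_orientation K K' o o' ->
     admissible R K' o' C' ->
     same_form_forget R K' o' C' K o C [set d; e]).
Proof.
split; first by move=> C' hC'; apply: same_form_admissible.
split=> K' a b c d e o' C' M ho' so hC'.
  by apply: (same_form_move M) => //; left.
apply: (same_form_move M) => //; first by right.
by move=> x y z w tK' tK; rewrite so.
Qed.
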